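(* Let $L$ be a slim rectangular lattice. Then a natural diagram of $L$ is a $\mathcal{C}_1$-diagram. Conversely, every $\mathcal{C}_1$-diagram of $L$ is natural.
   Context: All lattices are finite. A planar lattice is a lattice with a planar Hasse diagram. A lattice is semimodular if $x\wedge y\prec x$ implies $y\prec x\vee y$; a planar semimodular lattice is slim if it contains no sublattice isomorphic to $\mathsf{M}_3$ (the five-element modular nondistributive lattice). An element is doubly-irreducible if it is both join- and meet-irreducible. A planar semimodular lattice is rectangular if its left boundary chain has exactly one doubly-irreducible element other than the bounds (the left corner), its right boundary chain has exactly one doubly-irreducible element other than the bounds (the right corner), and the two corners are complementary. A slim rectangular lattice is a rectangular lattice that is slim. A diagram of a planar lattice is a planar Hasse diagram drawn in the Euclidean plane with straight line segments as edges. Natural diagrams. For a slim rectangular lattice $L$ let $\mathrm{lc}(L)$ and $\mathrm{rc}(L)$ be its left and right corners, and let $\mathrm{C}_l(L)=[0,\mathrm{lc}(L)]$ and $\mathrm{C}_r(L)=[0,\mathrm{rc}(L)]$ be its lower left and lower right boundary chains. Regard $G=\mathrm{C}_l(L)\times \mathrm{C}_r(L)$ as a planar lattice (a grid, drawn with all edges of slope $45^\circ$ or $135^\circ$), with $\mathrm{C}_l(L)$ and $\mathrm{C}_r(L)$ as its lower left and lower right boundary chains; the lengths of the edges of these two chains in the drawing may be chosen arbitrarily. The map $$\psi\colon L\to G,\qquad x\mapsto (x\wedge \mathrm{lc}(L),\,x\wedge \mathrm{rc}(L))$$ is a meet-embedding preserving the bounds. The image of $L$ under $\psi$ in $G$ is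 a diagram of $L$ (each $x$ is placed at the point $\psi(x)$ of the drawing of $G$, and covering pairs of $L$ are joined by straight segments); it is called a natural diagram of $L$. For a given diagram of $L$, left and right (hence the corners and the chains) are taken with respect to that diagram. $\mathcal{C}_1$-diagrams. In a diagram, an edge is normal if it has slope $45^\circ$ or $135^\circ$, and steep if its slope is strictly between $45^\circ$ and $135^\circ$. The lattice $\mathsf{S}_7$ is the seven-element slim rectangular lattice $\{o,\,m\wedge a,\,m\wedge b,\,a,\,b,\,m,\,t\}$ with bottom $o$ and top $t$ and covering relations $o\prec m\wedge a$, $o\prec m\wedge b$, $m\wedge a\prec a$, $m\wedge a\prec m$, $m\wedge b\prec m$, $m\wedge b\prec b$, $a\prec t$, $m\prec t$, $b\prec t$, where $a$ is the left corner, $b$ the right corner and $m$ the middle element. A peak sublattice of $L$ is a sublattice isomorphic to $\mathsf{S}_7$ such that the three edges at the top ($a$–$t$, $m$–$t$, $b$–$t$) are coverings in $L$; its middle edge is $m$–$t$. A diagram of a slim rectangular lattice $L$ is a $\mathcal{C}_1$-diagram if every edge that is the middle edge of a peak sublattice is steep and all other edges are normal. *)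

(* Defs.v *)
From mathcomp Require Import all_boot all_order all_algebra.
From mathcomp Require Import reals.
From Stdlib Require Import Relation_Operators.

Set Implicit Arguments.
Unset Strict Implicit.
Unset Printing Implicit Defensive.

Import Order.TTheory GRing.Theory Num.Theory.

Section LatticeNotions.
Local Open Scope order_scope.
Context {d : Order.disp_t} {L : finTBLatticeType d}.
Implicit Types (x y z u v : L) (C : {set L}).

Definition covers x y : bool := (x < y) && [forall z, ~~ (x < z < y)].

Definition join_irreducible x : Prop :=
  x != \bot /\ forall y z, x = y `|` z -> x = y \/ x = z.

Definition meet_irreducible x : Prop :=
  x != \top /\ forall y z, x = y `&` z -> x = y \/ x = z.

Definition doubly_irreducible x : Prop :=
  join_irreducible x /\ meet_irreducible x.

Definition complementary x y : Prop := x `&` y = \bot /\ x `|` y = \top.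

Definition maximal_chain C : Prop :=
  (forall x y, x \in C -> y \in C -> x >=< y) /\
  (forall z, (forall x, x \in C -> z >=< x) -> z \in C).

(* The range of [f] is a sublattice of [L], isomorphic to the lattice on [K]
   whose covering relation is [cov] (an order isomorphism between lattices is
   a lattice isomorphism). *)
Definition sublattice_copy (K : Type) (cov : K -> K -> Prop) (f : K -> L)
    : Prop :=
  [/\ forall i j, f i <= f j <-> clos_refl_trans K cov i j,
      forall i j, exists k, f k = f i `&` f j
    & forall i j, exists k, f k = f i `|` f j].

End LatticeNotions.

Inductive M3 : Set := M3_o | M3_a | M3_b | M3_c | M3_i.

Definition M3_cov (x y : M3) : Prop :=
  match x, y with
  | M3_o, (M3_a | M3_b | M3_c) => True
  | (M3_a | M3_b | M3_c), M3_i => True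
  | _, _ => False
  end.

(* [S7_ma] and [S7_mb] are the meets of [S7_m] with [S7_a] and [S7_b]. *)
Inductive S7 : Set := S7_o | S7_ma | S7_mb | S7_a | S7_b | S7_m | S7_t.

Definition S7_cov (x y : S7) : Prop :=
  match x, y with
  | S7_o, (S7_ma | S7_mb) => True
  | S7_ma, (S7_a | S7_m) => True
  | S7_mb, (S7_m | S7_b) => True
  | (S7_a | S7_m | S7_b), S7_t => True
  | _, _ => False
  end.

Section Classes.
Local Open Scope order_scope.
Context {d : Order.disp_t} (L : finTBLatticeType d).

Definition semimodular : Prop :=
  forall x y : L, covers (x `&` y) x -> covers y (x `|` y).

Definition slim : Prop := ~ exists f : M3 -> L, sublattice_copy M3_cov f.

(* The edge from [x] to [y] is the middle edge of a peak sublattice. *)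
Definition peak_middle_edge (x y : L) : Prop :=
  exists f : S7 -> L,
    [/\ sublattice_copy S7_cov f,
        [/\ covers (f S7_a) (f S7_t), covers (f S7_m) (f S7_t)
          & covers (f S7_b) (f S7_t)],
        x = f S7_m
      & y = f S7_t].

End Classes.

Section Plane.
Local Open Scope ring_scope.
Context {R : realType}.
Implicit Types p q r : R * R.

Definition on_segment p r q : Prop :=
  exists2 t : R, 0 <= t <= 1 &
    q = ((1 - t) * p.1 + t * r.1, (1 - t) * p.2 + t * r.2).

(* For [p] lower than [r]: the height of [q] is between those of [p] and [r],
   and [q] is on, or to the right (left) of, the segment from [p] to [r]. *)
Definition level_with p r q : bool := p.2 <= q.2 <= r.2.
Definition weakly_right_of p r q : bool :=
  (r.1 - p.1) * (q.2 - p.2) <= (q.1 - p.1) * (r.2 - p.2).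
Definition weakly_left_of p r q : bool :=
  (q.1 - p.1) * (r.2 - p.2) <= (r.1 - p.1) * (q.2 - p.2).

(* Edges of a diagram are directed upwards, from [p] to [r] with
   [p.2 < r.2]; then an angle of 45 or 135 degrees means that the horizontal
   and vertical displacements have the same size, and a strictly intermediate
   angle that the vertical one is larger. *)
Definition normal_edge p r : bool := `|r.1 - p.1| == r.2 - p.2.
Definition steep_edge p r : bool := `|r.1 - p.1| < r.2 - p.2.

End Plane.

Section Diagrams.
Local Open Scope ring_scope.
Context {R : realType} {d : Order.disp_t} {L : finTBLatticeType d}.
Implicit Types (D : L -> R * R) (C : {set L}).

(* A diagram is given by the position of each element; its edges are the
   straight segments joining covering pairs.  Planarity: distinct edges meet
   only in the position of a common endpoint. *)
Definition is_diagram D : Prop :=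
  [/\ injective D,
      forall x y, covers x y -> (D x).2 < (D y).2
    & forall x y u v q, covers x y -> covers u v -> (x, y) <> (u, v) ->
        on_segment (D x) (D y) q -> on_segment (D u) (D v) q ->
        exists z, [/\ z = x \/ z = y, z = u \/ z = v & q = D z]].

(* The left boundary chain is the maximal chain having every element on it or
   to its right: since heights increase along the chain, its polygonal path
   has exactly one point at the height of any given element. *)
Definition left_boundary_chain D C : Prop :=
  maximal_chain C /\
  forall u v x, u \in C -> v \in C -> covers u v ->
    level_with (D u) (D v) (D x) -> weakly_right_of (D u) (D v) (D x).

Definition right_boundary_chain D C : Prop :=
  maximal_chain C /\
  forall u v x, u \in C -> v \in C -> covers u v ->
    level_with (D u) (D v) (D x) -> weakly_left_of (D u) (D v) (D x).

Definition proper_doubly_irreducible (x : L) : Prop :=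
  [/\ x != \bot%O, x != \top%O & doubly_irreducible x].

Definition only_proper_doubly_irreducible C (c : L) : Prop :=
  [/\ c \in C, proper_doubly_irreducible c
    & forall x, x \in C -> proper_doubly_irreducible x -> x = c].

(* With respect to the diagram [D], the lattice satisfies the conditions on
   boundary chains defining rectangularity, with left corner [lc] and right
   corner [rc]. *)
Definition rectangular_corners D (lc rc : L) : Prop :=
  [/\ exists2 C, left_boundary_chain D C & only_proper_doubly_irreducible C lc,
      exists2 C, right_boundary_chain D C & only_proper_doubly_irreducible C rc
    & complementary lc rc].

Definition C1_diagram D : Prop :=
  is_diagram D /\
  forall x y, covers x y ->
    (peak_middle_edge x y -> steep_edge (D x) (D y)) /\
    (~ peak_middle_edge x y -> normal_edge (D x) (D y)).

Definition strictly_increasing_below (c : L) (h : L -> R) : Prop :=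
  forall x y, (x < y)%O -> (y <= c)%O -> h x < h y.

Definition psi (lc rc x : L) : L * L := ((x `&` lc)%O, (x `&` rc)%O).

(* The point of the grid [0, lc] x [0, rc] with coordinates [g], when the
   lower left chain is drawn in direction (-1, 1), the lower right chain in
   direction (1, 1), and [lam] and [rho] measure the positions along them.
   An edge from [x] to [y] of the lower left chain has length
   [(lam y - lam x) * sqrt 2], so that choosing positive edge lengths amounts
   to choosing a strictly increasing [lam], and likewise for [rho]; the values
   at bottom only translate the drawing. *)
Definition grid_point (lam rho : L -> R) (g : L * L) : R * R :=
  (rho g.2 - lam g.1, rho g.2 + lam g.1).

(* [D] is a natural diagram, the corners being taken with respect to [D0]. *)
Definition natural_diagram D0 D : Prop :=
  exists lc rc : L, rectangular_corners D0 lc rc /\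
  exists lam rho : L -> R,
    [/\ strictly_increasing_below lc lam, strictly_increasing_below rc rho
      & forall x, D x = grid_point lam rho (psi lc rc x)].

End Diagrams.

(* Planarity is part of rectangularity; [R] is the field of coordinates of the
   plane in which diagrams are drawn. *)
Definition rectangular (R : realType) (d : Order.disp_t)
    (L : finTBLatticeType d) : Prop :=
  semimodular L /\
  exists2 D : L -> R * R, is_diagram D &
    exists lc rc : L, rectangular_corners D lc rc.

Definition slim_rectangular (R : realType) (d : Order.disp_t)
    (L : finTBLatticeType d) : Prop :=
  rectangular R L /\ slim L.

(* Main.v *)
Require Import Defs.
From mathcomp Require Import all_boot all_order all_algebra.
From mathcomp Require Import reals.
From mathcomp Require Import ring lra.
From Stdlib Require Import Relation_Operators.

(* Planarity of a diagram is used only through paths of coverings: an edge that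
   is on one side of such a path stays there until it meets an element of the
   path.  With semimodularity and slimness this shows that no element has three
   upper covers, and that every join-irreducible element is on a boundary
   chain.  Hence the corners are the only proper doubly irreducible elements,
   and climbing from a join-irreducible element through join-irreducible covers
   ends in a corner: the join-irreducible elements are those of the chains
   [0, lc] and [0, rc] other than 0, so that [psi] is injective.

   A meet-embedding into a product of two chains always draws a planar diagram:
   if the edges [x, y] and [u, v] meet, then [y /\ v] is an end of both.  An
   edge of it is steep when both coordinates change, which characterizes the
   middle edges of peak sublattices.

   Conversely, in a C1-diagram the two normal edges going up from an element
   have different directions, and the slope conditions transport directions
   from the lower to the upper edges of a covering square.  So all edges that
   keep [x /\ rc] have one direction and all those that keep [x /\ lc] the
   other one, which gives the natural coordinates. *)

Set Implicit Arguments.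
Unset Strict Implicit.
Unset Printing Implicit Defensive.

Import Order.TTheory GRing.Theory Num.Theory.

(** * Coverings, irreducible elements and semimodularity in a finite lattice *)

Section Covers.
Local Open Scope order_scope.
Context {d : Order.disp_t} {L : finTBLatticeType d}.
Implicit Types (x y z u v w p q r : L) (s : seq L).

Lemma lt_wf_ind (P : L -> Prop) :
  (forall x, (forall y, y < x -> P y) -> P x) -> forall x, P x.
Proof.
move=> IH x; have [n] := ubnP #|[set z | z < x]|.
elim: n x => // n IHn x lexn; apply: IH => y ltyx; apply: IHn.
rewrite ltnS in lexn; apply: leq_trans lexn; apply: proper_card.
apply/properP; split; first by apply/subsetP => z; rewrite !inE => /lt_trans; apply.
by exists y; rewrite !inE ?ltxx.
Qed.

Lemma gt_wf_ind (P : L -> Prop) :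
  (forall x, (forall y, x < y -> P y) -> P x) -> forall x, P x.
Proof.
move=> IH x; have [n] := ubnP #|[set z | x < z]|.
elim: n x => // n IHn x lexn; apply: IH => y ltxy; apply: IHn.
rewrite ltnS in lexn; apply: leq_trans lexn; apply: proper_card.
apply/properP; split; first by apply/subsetP => z; rewrite !inE; apply: lt_trans.
by exists y; rewrite !inE ?ltxx.
Qed.

Lemma covers_lt x y : covers x y -> x < y.
Proof. by case/andP. Qed.

Lemma covers_le x y : covers x y -> x <= y.
Proof. by move/covers_lt/ltW. Qed.

Lemma covers_between x y z : covers x y -> x <= z -> z <= y -> z = x \/ z = y.
Proof.
case/andP=> _ /forallP/(_ z); rewrite !lt_neqAle negb_and.
case: (eqVneq x z) => [->|_]; first by left.
case: (eqVneq z y) => [->|_]; first by right.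
by move=> + lexz lezy; rewrite lexz lezy.
Qed.

Lemma coversNP x y : x < y -> ~~ covers x y -> exists z, x < z < y.
Proof.
by rewrite /covers => ->; rewrite negb_forall => /existsP[z]; rewrite negbK; exists z.
Qed.

Lemma ex_upper_cover x y : x < y -> exists2 u, covers x u & u <= y.
Proof.
elim/lt_wf_ind: y => y IH ltxy.
have [cxy|/(coversNP ltxy)[z /andP[ltxz ltzy]]] := boolP (covers x y); first by exists y.
have [u cxu leuz] := IH z ltzy ltxz.
by exists u => //; apply: le_trans leuz (ltW ltzy).
Qed.

Lemma ex_lower_cover x y : x < y -> exists2 u, covers u y & x <= u.
Proof.
elim/gt_wf_ind: x => x IH ltxy.
have [cxy|/(coversNP ltxy)[z /andP[ltxz ltzy]]] := boolP (covers x y); first by exists x.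
have [u cuy lezu] := IH z ltxz ltzy.
by exists u => //; apply: le_trans (ltW ltxz) lezu.
Qed.

Lemma covers_path x y : x <= y -> exists2 s, path covers x s & last x s = y.
Proof.
elim/gt_wf_ind: x => x IH; rewrite le_eqVlt => /predU1P[<-|]; first by exists [::].
case/ex_upper_cover=> u cxu leuy.
have [s pus lasts] := IH u (covers_lt cxu) leuy.
by exists (u :: s) => //=; rewrite cxu.
Qed.

Lemma path_covers_lt x s z : path covers x s -> z \in s -> x < z.
Proof.
elim: s x => //= y s IH x /andP[cxy pys]; rewrite inE => /predU1P[->|zs].
  exact: covers_lt.
exact: lt_trans (covers_lt cxy) (IH _ pys zs).
Qed.

Lemma path_covers_le_last x s z :
  path covers x s -> z \in x :: s -> z <= last x s.
Proof.
elim: s x z => [|y s IH] x z /=; first by rewrite inE => _ /eqP->.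
case/andP=> cxy pys; rewrite inE => /predU1P[->|]; last exact: IH.
by apply: le_trans (covers_le cxy) (IH y y pys _); rewrite mem_head.
Qed.

Lemma covers_incomp x a b : covers x a -> covers x b -> a <= b -> a = b.
Proof.
move=> cxa cxb leab.
have [eax|//] := covers_between cxb (covers_le cxa) leab.
by move: (covers_lt cxa); rewrite eax ltxx.
Qed.

Lemma lower_covers_incomp x a b : covers a x -> covers b x -> a <= b -> a = b.
Proof.
move=> cax cbx leab.
have [//|ebx] := covers_between cax leab (covers_le cbx).
by move: (covers_lt cbx); rewrite ebx ltxx.
Qed.

Lemma covers_meet x a b : covers x a -> covers x b -> a != b -> a `&` b = x.
Proof.
move=> cxa cxb neab.
have [||//|E] := covers_between cxa (z := a `&` b); rewrite ?lexI ?(covers_le cxa) ?(covers_le cxb) ?leIl //.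
by case/negP: neab; apply/eqP; apply: covers_incomp cxa cxb _; rewrite -E leIr.
Qed.

Lemma covers_join a b x : covers a x -> covers b x -> a != b -> a `|` b = x.
Proof.
move=> cax cbx neab.
have [||E|//] := covers_between cax (z := a `|` b); rewrite ?leUx ?(covers_le cax) ?(covers_le cbx) ?leUl //.
case/negP: neab; rewrite eq_sym; apply/eqP; apply: lower_covers_incomp cbx cax _.
by rewrite -E leUr.
Qed.

(** Otherwise the join of [q] and [z] would be [p], a join of two smaller elements. *)
Lemma join_irreducible_lower_cover p q z :
  join_irreducible p -> covers q p -> z < p -> z <= q.
Proof.
move=> [_ pJ] cqp ltzp; apply/idPn => nzq.
have [||E|E] := covers_between cqp (z := q `|` z); rewrite ?leUl ?leUx ?(covers_le cqp) ?(ltW ltzp) //.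
  by case/negP: nzq; rewrite -E leUr.
have [e|e] := pJ q z (esym E).
  by move: (covers_lt cqp); rewrite e ltxx.
by move: ltzp; rewrite e ltxx.
Qed.

(** Decidable form, by uniqueness of the lower cover, so that one may ask whether some cover is
    join-irreducible. *)
Definition jirr p := (p != \bot) &&
  [forall a, forall b, covers a p ==> covers b p ==> (a == b)].

Lemma jirrP p : reflect (join_irreducible p) (jirr p).
Proof.
apply: (iffP andP) => -[p0 H]; split=> //.
  move=> y z pE; have [/eqP->|npy] := boolP (p == y); first by left.
  have [/eqP->|npz] := boolP (p == z); first by right.
  have ltyp : y < p by rewrite lt_neqAle eq_sym npy pE leUl.
  have ltzp : z < p by rewrite lt_neqAle eq_sym npz pE leUr.
  have [a cap leya] := ex_lower_cover ltyp.
  have [b cbp lezb] := ex_lower_cover ltzp.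
  move/forallP/(_ a)/forallP/(_ b): H; rewrite cap cbp /= => /eqP eab.
  by move: (covers_lt cap); rewrite lt_leAnge pE leUx leya eab lezb andbF.
apply/forallP => a; apply/forallP => b; apply/implyP => cap; apply/implyP => cbp.
apply/eqP/(lower_covers_incomp cap cbp).
by apply: join_irreducible_lower_cover cbp (covers_lt cap).
Qed.

Lemma unique_upper_cover_meet_irreducible p : p != \top ->
  (forall a b, covers p a -> covers p b -> a = b) -> meet_irreducible p.
Proof.
move=> pT H; split=> // y z pE.
have [/eqP->|npy] := boolP (p == y); first by left.
have [/eqP->|npz] := boolP (p == z); first by right.
have [a cpa leay] : exists2 u, covers p u & u <= y.
  by apply: ex_upper_cover; rewrite lt_neqAle npy pE leIl.
have [b cpb lebz] : exists2 u, covers p u & u <= z.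
  by apply: ex_upper_cover; rewrite lt_neqAle npz pE leIr.
move: (covers_lt cpa); rewrite lt_leAnge {2}pE lexI leay.
by rewrite (H _ _ cpa cpb) lebz andbF.
Qed.

Lemma ex_join_irreducible x y : ~~ (x <= y) ->
  exists p, [/\ join_irreducible p, p <= x & ~~ (p <= y)].
Proof.
elim/lt_wf_ind: x => x IH nxy.
have [/existsP[z /andP[ltzx nzy]]|] := boolP [exists z, (z < x) && ~~ (z <= y)].
  have [p [pJ lepz npy]] := IH z ltzx nzy.
  by exists p; split=> //; apply: le_trans lepz (ltW ltzx).
rewrite negb_exists => /forallP H; exists x; split=> //; split.
  by apply: contraNneq nxy => ->; apply: le0x.
move=> a b xE; have [/eqP->|nxa] := boolP (x == a); first by left.
have [/eqP->|nxb] := boolP (x == b); first by right.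
case/negP: nxy; rewrite xE leUx.
have := H a; rewrite lt_neqAle eq_sym nxa {1}xE leUl /= negbK => ->.
by have := H b; rewrite lt_neqAle eq_sym nxb {1}xE leUr /= negbK.
Qed.

Lemma semimodular_cover_join a b q : semimodular L ->
  covers a b -> a <= q -> ~~ (b <= q) -> covers q (b `|` q).
Proof.
move=> sm cab leaq nbq; apply: sm.
have [||->//|E] := covers_between cab (z := b `&` q).
- by rewrite lexI leaq covers_le.
- exact: leIl.
- by case/negP: nbq; rewrite -E leIr.
Qed.

(** Let [w] be another lower cover of [v]. Its meet with [p] is below [q], and joining to [q] or to
    [p] an element [z1] that covers this meet below [w] gives a cover by semimodularity: the first
    is [r], the second is [v]. *)
Lemma non_join_irreducible_cover p q v : semimodular L ->
  join_irreducible p -> covers q p -> covers p v -> ~~ jirr v ->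
  exists r, [/\ covers q r, r != p & r `|` p = v].
Proof.
move=> sm pJ cqp cpv; rewrite negb_and negbK.
case/orP=> [/eqP v0|]; first by move: (covers_lt cpv); rewrite v0 ltx0.
rewrite negb_forall => /existsP[a]; rewrite negb_forall => /existsP[b].
rewrite !negb_imply => /and3P[cav cbv neab].
have [w cwv newp] : exists2 w, covers w v & w != p.
  have [eap|neap] := eqVneq a p; last by exists a.
  by exists b; rewrite // -eap eq_sym.
have npw : ~~ (p <= w).
  by apply: contraNN newp => /(lower_covers_incomp cpv cwv)->.
have nwp : ~~ (w <= p).
  by apply: contraNN newp => /(lower_covers_incomp cwv cpv)->.
have ltzp : w `&` p < p by rewrite lt_neqAle leIr andbT eq_meetr.
have ltzw : w `&` p < w by rewrite lt_neqAle leIl andbT eq_meetl.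
have lezq := join_irreducible_lower_cover pJ cqp ltzp.
have [z1 czz1 lez1w] := ex_upper_cover ltzw.
have nz1p : ~~ (z1 <= p).
  apply/negP => lez1p; move: (covers_lt czz1).
  by rewrite lt_leAnge lexI lez1w lez1p andbF.
have nz1q : ~~ (z1 <= q).
  by apply: contraNN nz1p => /le_trans; apply; apply: covers_le.
exists (z1 `|` q); split; first exact: semimodular_cover_join czz1 lezq nz1q.
  by apply: contraNneq nz1p => <-; apply: leUl.
have cz := semimodular_cover_join sm czz1 (ltW ltzp) nz1p.
rewrite -joinA (join_r (covers_le cqp)); apply: (covers_incomp cz cpv).
by rewrite leUx (le_trans lez1w (covers_le cwv)) covers_le.
Qed.

End Covers.

(** * Sides of a line and points of a segment *)

Section Geometry.
Local Open Scope ring_scope.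
Context {R : realType}.
Implicit Types (e t : R) (p q r u v : R * R).

(* Negative exactly when [q] is strictly to the left of the upward line
   through [p] and [r]. *)
Definition cross p r q : R :=
  (q.1 - p.1) * (r.2 - p.2) - (r.1 - p.1) * (q.2 - p.2).

Definition seg p r t : R * R :=
  ((1 - t) * p.1 + t * r.1, (1 - t) * p.2 + t * r.2).


Lemma cross_seg u v p r t :
  cross u v (seg p r t) = (1 - t) * cross u v p + t * cross u v r.
Proof. rewrite /cross /seg /=; ring. Qed.

Lemma crossC p r q : cross p r q = - cross p q r.
Proof. rewrite /cross; ring. Qed.

Lemma cross_top p r q : q.2 = r.2 -> cross p r q = (q.1 - r.1) * (r.2 - p.2).
Proof. by rewrite /cross => ->; ring. Qed.

Lemma cross_bottom p r q : q.2 = p.2 -> cross p r q = (q.1 - p.1) * (r.2 - p.2).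
Proof. by rewrite /cross => ->; ring. Qed.

Lemma seg0 p r : seg p r 0 = p.
Proof. by case: p => a b; rewrite /seg /= subr0 !mul1r !mul0r !addr0. Qed.

Lemma seg1 p r : seg p r 1 = r.
Proof. by case: r => a b; rewrite /seg /= subrr !mul1r !mul0r !add0r. Qed.

Lemma seg_height p r t : (seg p r t).2 = p.2 + t * (r.2 - p.2).
Proof. rewrite /seg /=; ring. Qed.

Lemma seg_at_height p r h : p.2 < r.2 ->
  (seg p r ((h - p.2) / (r.2 - p.2))).2 = h.
Proof. by move=> pr; rewrite seg_height divfK ?subr_eq0 ?gt_eqF //; ring. Qed.

Lemma on_segment_seg p r t : 0 <= t <= 1 -> on_segment p r (seg p r t).
Proof. by exists t. Qed.

Lemma on_segment_cross p r q : p.2 < r.2 -> cross p r q = 0 ->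
  p.2 <= q.2 <= r.2 -> on_segment p r q.
Proof.
move=> pr c0 /andP[pq qr].
have dgt0 : 0 < r.2 - p.2 by rewrite subr_gt0.
exists ((q.2 - p.2) / (r.2 - p.2)).
  apply/andP; split; first by rewrite divr_ge0 ?subr_ge0 ?(ltW pr).
  by rewrite ler_pdivrMr // mul1r lerD2r.
have d0 : r.2 - p.2 != 0 by rewrite gt_eqF.
rewrite [LHS]surjective_pairing; congr (_, _); last by field.
apply: (mulIf d0); rewrite mulrDl.
have -> : (1 - (q.2 - p.2) / (r.2 - p.2)) * p.1 * (r.2 - p.2) +
   (q.2 - p.2) / (r.2 - p.2) * r.1 * (r.2 - p.2) =
   p.1 * (r.2 - p.2) + (r.1 - p.1) * (q.2 - p.2) by field.
by move: c0; rewrite /cross => c0; lra.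
Qed.

Lemma affine_root (a b t t1 : R) : t <= t1 ->
  (1 - t) * a + t * b < 0 -> 0 <= (1 - t1) * a + t1 * b ->
  exists t2, [/\ t < t2, t2 <= t1 & (1 - t2) * a + t2 * b = 0].
Proof.
move=> tt1 H H1.
have ab : 0 < b - a.
  rewrite ltNge; apply/negP => ba.
  have : (t1 - t) * (b - a) <= 0 by rewrite mulr_ge0_le0 // subr_ge0.
  by lra.
exists (- a / (b - a)); split.
- by rewrite ltr_pdivlMr //; lra.
- by rewrite ler_pdivrMr //; lra.
- by field; rewrite gt_eqF.
Qed.

End Geometry.

#[local] Opaque seg.

(** * Edges of a planar diagram do not cross paths of coverings *)

Section Paths.
Local Open Scope ring_scope.
Context {R : realType} {d : Order.disp_t} {L : finTBLatticeType d}.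
Context (D : L -> R * R) (hD : is_diagram D).
Implicit Types (e t : R) (q : R * R) (x y z u v : L) (s : seq L).

Lemma diagram_height_lt x y : (x < y)%O -> (D x).2 < (D y).2.
Proof.
case: hD => _ up _ ltxy.
have [s] := covers_path (ltW ltxy).
elim: s x ltxy => [|z s IH] x ltxy /=; first by move=> _ xy; rewrite xy ltxx in ltxy.
case/andP=> cxz ps lasts.
have [zy|nzy] := eqVneq z y; first by rewrite -zy; apply: up.
apply: lt_trans (up _ _ cxz) (IH z _ ps lasts).
by rewrite lt_neqAle nzy -lasts path_covers_le_last ?mem_head.
Qed.

Lemma diagram_height_le x y : (x <= y)%O -> (D x).2 <= (D y).2.
Proof. by rewrite le_eqVlt => /predU1P[->//|/diagram_height_lt/ltW]. Qed.

(* [e * side u s q < 0] says that [q] is strictly to the left (for [e > 0], to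
   the right for [e < 0]) of the polygonal path [u :: s]; only meaningful for
   [q] between the levels of its ends. *)
Fixpoint side u s q : R :=
  if s is v :: s' then
    if q.2 <= (D v).2 then cross (D u) (D v) q else side v s' q
  else 0.

(** The cross product is affine along the edge, so a change of sign gives a common point of the two
    edges. By planarity it would be a common end, but it is strictly above [x], and [y] is neither
    [u] nor [v]. *)
Lemma no_crossing e x y u v t t1 : covers x y -> covers u v ->
  y != u -> y != v -> 0 <= t -> t <= t1 -> t1 <= 1 ->
  (D u).2 <= (seg (D x) (D y) t).2 -> (seg (D x) (D y) t1).2 <= (D v).2 ->
  e * cross (D u) (D v) (seg (D x) (D y) t) < 0 ->
  e * cross (D u) (D v) (seg (D x) (D y) t1) < 0.
Proof.
move=> cxy cuv nyu nyv t0 tt1 t11 hu hv neg.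
have xy := diagram_height_lt (covers_lt cxy).
rewrite ltNge; apply/negP => pos.
have e0 : e != 0 by apply: contraTneq neg => ->; rewrite mul0r ltxx.
have affE t' : e * cross (D u) (D v) (seg (D x) (D y) t') =
    (1 - t') * (e * cross (D u) (D v) (D x)) + t' * (e * cross (D u) (D v) (D y)).
  by rewrite cross_seg; ring.
rewrite !affE in neg pos.
have [t2 [tt2 t21 E]] := affine_root tt1 neg pos.
have E0 : cross (D u) (D v) (seg (D x) (D y) t2) = 0.
  by apply: (mulfI e0); rewrite affE mulr0.
have h1 : (seg (D x) (D y) t).2 <= (seg (D x) (D y) t2).2.
  by rewrite !seg_height lerD2l ler_wpM2r ?subr_ge0 ?(ltW xy) ?(ltW tt2).
have h2 : (seg (D x) (D y) t2).2 <= (seg (D x) (D y) t1).2.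
  by rewrite !seg_height lerD2l ler_wpM2r ?subr_ge0 ?(ltW xy).
have on1 : on_segment (D x) (D y) (seg (D x) (D y) t2).
  by apply: on_segment_seg; lra.
have on2 : on_segment (D u) (D v) (seg (D x) (D y) t2).
  apply: on_segment_cross E0 _; first exact: diagram_height_lt (covers_lt cuv).
  by rewrite (le_trans hu h1) (le_trans h2 hv).
case: hD => _ _ /(_ x y u v _ cxy cuv _ on1 on2).
case=> [[_ yv]|z [[->|->] zuv qz]]; first by rewrite yv eqxx in nyv.
  have : (seg (D x) (D y) t2).2 = (D x).2 by rewrite qz.
  rewrite seg_height => /eqP; rewrite -subr_eq0 addrAC subrr add0r mulf_eq0.
  by rewrite subr_eq0 (gt_eqF xy) orbF gt_eqF // (le_lt_trans t0 tt2).
by case: zuv => yE; [rewrite yE eqxx in nyu|rewrite yE eqxx in nyv].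
Qed.

(** Induction along the path: [no_crossing] keeps the side up to the height of the next vertex,
    where the following edge of the path takes over. *)
Lemma walk e x y u s t : covers x y -> path covers u s -> last u s = \top%O ->
  y \notin u :: s -> 0 <= t -> t <= 1 -> (D u).2 <= (seg (D x) (D y) t).2 ->
  e * side u s (seg (D x) (D y) t) < 0 -> e * side u s (D y) < 0.
Proof.
move=> cxy; have xy := diagram_height_lt (covers_lt cxy).
elim: s u t => [|v s IH] u t /=; first by rewrite mulr0 ltxx.
move=> /andP[cuv ps] lasts; rewrite !inE !negb_or => /and3P[nyu nyv nys] t0 t1 hu.
have hty : (seg (D x) (D y) t).2 <= (D y).2.
  by rewrite -{2}(seg1 (D x) (D y)) !seg_height lerD2l ler_wpM2r ?subr_ge0 ?(ltW xy).
have nyvs : y \notin v :: s by rewrite inE negb_or nyv.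
case: (leP (D y).2 (D v).2) => [hyv|hvy].
  rewrite (le_trans hty hyv) -{2}(seg1 (D x) (D y)).
  by apply: no_crossing; rewrite ?seg1.
case: (leP (seg (D x) (D y) t).2 (D v).2) => [htv|hvt]; last first.
  by apply: IH => //; apply: ltW.
move=> neg.
(* The parameter at which the edge from [x] to [y] reaches the height of [v]. *)
pose t2 := ((D v).2 - (D x).2) / ((D y).2 - (D x).2).
have ht2 : (seg (D x) (D y) t2).2 = (D v).2 by apply: seg_at_height.
have dgt0 : 0 < (D y).2 - (D x).2 by rewrite subr_gt0.
have tt2 : t <= t2.
  by rewrite /t2 ler_pdivlMr //; rewrite seg_height in htv; lra.
have t21 : t2 <= 1 by rewrite /t2 ler_pdivrMr //; lra.
have neg2 : e * cross (D u) (D v) (seg (D x) (D y) t2) < 0.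
  by apply: no_crossing neg; rewrite ?ht2.
apply: (IH v t2) => //; rewrite ?ht2 ?(le_trans t0 tt2) //.
(* At the height of [v], the cross products with the edges below and above [v] are both the
   horizontal displacement from [v] times a positive height, so they have the same sign. *)
have uv : 0 < (D v).2 - (D u).2 by rewrite subr_gt0 diagram_height_lt ?covers_lt.
rewrite cross_top // mulrA pmulr_llt0 // in neg2.
case: s lasts ps {IH nys nyvs} => [/= vtop|w s _ /= /andP[cvw _]].
  by move: hvy; rewrite vtop ltNge diagram_height_le ?lex1.
have vw := diagram_height_lt (covers_lt cvw).
by rewrite /= ht2 (ltW vw) cross_bottom // mulrA pmulr_llt0 // subr_gt0.
Qed.

(** The edge starts on the path, where the cross product vanishes. So [walk] is started at the
    height of [v], unless [y] is not above that height. *)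
Lemma side_start e u v y s : covers u y -> path covers u (v :: s) ->
  last v s = \top%O -> y != v -> e * cross (D u) (D v) (D y) < 0 ->
  e * side u (v :: s) (D y) < 0.
Proof.
move=> cuy puvs lasts nyv neg.
have uy := diagram_height_lt (covers_lt cuy).
have [hyv|hvy] := leP (D y).2 (D v).2; first by rewrite /= hyv.
have /= /andP[cuv ps] := puvs.
have uv := diagram_height_lt (covers_lt cuv).
have dgt0 : 0 < (D y).2 - (D u).2 by rewrite subr_gt0.
have ht := seg_at_height (D v).2 uy.
set t := (X in seg _ _ X) in ht.
have t0 : 0 < t by rewrite divr_gt0 ?subr_gt0.
have t1 : t <= 1 by rewrite ler_pdivrMr //; lra.
apply: (walk (t := t) cuy puvs lasts) => //; rewrite ?ht ?(ltW t0) ?(ltW uv) //.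
  rewrite !inE !negb_or nyv gt_eqF ?covers_lt //=.
  apply/negP => /(path_covers_lt ps) ltvy.
  have [E|E] := covers_between cuy (covers_le cuv) (ltW ltvy).
    by move: (covers_lt cuv); rewrite E ltxx.
  by rewrite E eqxx in nyv.
rewrite /= ht lexx cross_seg.
have -> : cross (D u) (D v) (D u) = 0 by rewrite /cross; ring.
by rewrite mulr0 add0r mulrCA pmulr_rlt0.
Qed.

(** Two edges going up from [u] in one direction would overlap: the lower of their tops would lie on
    the other edge. *)
Lemma cross_covers_neq0 u v y : covers u v -> covers u y -> y != v ->
  cross (D u) (D v) (D y) != 0.
Proof.
wlog hyv : v y / (D y).2 <= (D v).2.
  move=> IH; have [/IH//|/ltW/IH H] := leP (D y).2 (D v).2.
  by move=> cuv cuy nyv; rewrite crossC oppr_eq0; apply: H; rewrite // eq_sym.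
move=> cuv cuy nyv; apply/negP => /eqP c0.
have uv := diagram_height_lt (covers_lt cuv).
have uy := diagram_height_lt (covers_lt cuy).
have on1 : on_segment (D u) (D v) (D y).
  by apply: on_segment_cross => //; rewrite (ltW uy).
have on2 : on_segment (D u) (D y) (D y).
  by rewrite -{2}(seg1 (D u) (D y)); apply: on_segment_seg; rewrite ler01 lexx.
case: hD => inj _ /(_ u v u y _ cuv cuy _ on1 on2).
case=> [[vy]|z [zuv _ /inj yz]]; first by rewrite vy eqxx in nyv.
by case: zuv => zE; move: uy nyv; rewrite yz zE ?ltxx ?eqxx.
Qed.

(** Apply [walk] to each edge of a path of coverings from [y] to [y']. *)
Lemma side_le e u s y y' : path covers u s -> last u s = \top%O ->
  (u <= y)%O -> (y <= y')%O ->
  (forall z, z \in u :: s -> (y <= z)%O -> (z <= y')%O -> False) ->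
  e * side u s (D y) < 0 -> e * side u s (D y') < 0.
Proof.
move=> ps lasts + /covers_path[s' ps' lasts'].
elim: s' y ps' lasts' => [|y1 s' IH] y /=; first by move=> _ <-.
case/andP=> cyy1 ps' lasts' leuy nos neg.
have leyy1 := covers_le cyy1.
have ley1 : (y1 <= y')%O by rewrite -lasts' path_covers_le_last ?mem_head.
apply: (IH y1) => //; first exact: le_trans leuy leyy1.
  by move=> z zs /(le_trans leyy1); apply: nos.
apply: (walk cyy1 ps lasts (t := 0)); rewrite ?seg0 ?diagram_height_le //.
by apply/negP => /nos; apply.
Qed.

(** Horizontal over vertical displacement, which orders the upward edges of an element from left to
    right. *)
Definition slope x y := ((D y).1 - (D x).1) / ((D y).2 - (D x).2).

Lemma cross_slope_lt x a b : covers x a -> covers x b ->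
  slope x a < slope x b -> cross (D x) (D b) (D a) < 0.
Proof.
move=> /covers_lt/diagram_height_lt xa /covers_lt/diagram_height_lt xb.
rewrite /slope ltr_pdivrMr ?subr_gt0 // mulrAC ltr_pdivlMr ?subr_gt0 // => H.
by rewrite /cross; lra.
Qed.

Lemma slope_inj x a b : covers x a -> covers x b -> a != b ->
  slope x a != slope x b.
Proof.
move=> cxa cxb nab.
have xa := diagram_height_lt (covers_lt cxa).
have xb := diagram_height_lt (covers_lt cxb).
have da : (D a).2 - (D x).2 != 0 by rewrite subr_eq0 gt_eqF.
have db : (D b).2 - (D x).2 != 0 by rewrite subr_eq0 gt_eqF.
apply: contra (cross_covers_neq0 cxb cxa nab).
by rewrite /slope eqr_div // => /eqP E; rewrite /cross E subrr.
Qed.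

(** A path from [x] through [b] to the top has [a] and [c] on opposite sides. If the join of [a] and
    [c] were not above [b], then climbing to it from [a] and from [c] would avoid the path and put
    it on both sides. *)
Lemma middle_cover_le x a b c : covers x a -> covers x b -> covers x c ->
  slope x a < slope x b -> slope x b < slope x c -> (b <= a `|` c)%O.
Proof.
move=> cxa cxb cxc sab sbc.
have [s ps lasts] := covers_path (lex1 b).
have pxbs : path covers x (b :: s) by rewrite /= cxb.
have nab : a != b by apply: contraTneq sab => ->; rewrite ltxx.
have ncb : c != b by apply: contraTneq sbc => ->; rewrite ltxx.
apply/idPn => nbac.
have sideP e y : covers x y -> y != b -> (y <= a `|` c)%O ->
    e * cross (D x) (D b) (D y) < 0 ->
    e * side x (b :: s) (D (a `|` c)%O) < 0.
  move=> cxy nyb leyac neg.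
  apply: side_le (side_start cxy pxbs lasts nyb neg) => //.
    exact: covers_le.
  move=> z; rewrite inE => /predU1P[->|zs] leyz lezac.
    by move: (lt_le_trans (covers_lt cxy) leyz); rewrite ltxx.
  case/negP: nbac; apply: le_trans lezac.
  move: zs; rewrite inE => /predU1P[->//|/(path_covers_lt ps)/ltW//].
have := sideP 1 a cxa nab (leUl _ _).
have := sideP (-1) c cxc ncb (leUr _ _).
rewrite !mul1r !mulN1r !oppr_lt0 crossC oppr_gt0.
by move=> /(_ (cross_slope_lt cxb cxc sbc)) ? /(_ (cross_slope_lt cxa cxb sab)) ?; lra.
Qed.

End Paths.

(** * Recognizing a copy of [M3] *)

Section Sublattices.
Local Open Scope order_scope.
Context {d : Order.disp_t} {L : finTBLatticeType d}.

Lemma clos_refl_trans_le (K : Type) (cov : K -> K -> Prop) (f : K -> L) :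
  (forall i j, cov i j -> f i <= f j) ->
  forall i j, clos_refl_trans K cov i j -> f i <= f j.
Proof.
by move=> H i j; elim=> [x y /H//|x|x y z _ xy _ yz] //; apply: le_trans xy yz.
Qed.

Lemma M3_sublattice (x a b c t : L) : covers x a -> covers x b -> covers x c ->
  a != b -> b != c -> a != c ->
  a `|` b = t -> b `|` c = t -> a `|` c = t -> ~ slim L.
Proof.
move=> cxa cxb cxc nab nbc nac jab jbc jac; apply.
pose f i := match i with
  | M3_o => x | M3_a => a | M3_b => b | M3_c => c | M3_i => t end.
have xa := covers_le cxa; have xb := covers_le cxb; have xc := covers_le cxc.
have at_ : a <= t by rewrite -jab leUl.
have bt : b <= t by rewrite -jab leUr.
have ct : c <= t by rewrite -jac leUr.
have xt : x <= t := le_trans xa at_.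
have mab := covers_meet cxa cxb nab; have mbc := covers_meet cxb cxc nbc.
have mac := covers_meet cxa cxc nac.
have nle y z : covers x y -> covers x z -> y != z -> y <= z = false.
  by move=> cxy cxz nyz; apply: contra_neqF nyz; apply: covers_incomp cxy cxz.
have nlex y : covers x y -> y <= x = false.
  by move/covers_lt; apply: contraTF => /le_gtF->.
have nlet y z : covers x y -> covers x z -> y != z -> t = y `|` z -> t <= y = false.
  move=> cxy cxz nyz tE; apply: contra_neqF nyz => tley.
  by apply/esym/(covers_incomp cxz cxy)/(le_trans _ tley); rewrite tE leUr.
have ab := nle _ _ cxa cxb nab; have bc := nle _ _ cxb cxc nbc.
have ac := nle _ _ cxa cxc nac.
have ba : b <= a = false by apply: nle; rewrite // eq_sym.
have cb : c <= b = false by apply: nle; rewrite // eq_sym.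
have ca : c <= a = false by apply: nle; rewrite // eq_sym.
have ax := nlex _ cxa; have bx := nlex _ cxb; have cx := nlex _ cxc.
have ta := nlet _ _ cxa cxb nab (esym jab).
have tb := nlet _ _ cxb cxc nbc (esym jbc).
have tc : t <= c = false by apply: (nlet c b); rewrite 1?eq_sym // joinC.
have tx : t <= x = false by apply: contraFF ax => /(le_trans at_).
have step i j : M3_cov i j -> clos_refl_trans M3 M3_cov i j by apply: rt_step.
exists f; split.
- move=> i j; split; last first.
    by apply: clos_refl_trans_le; case=> -[].
  case: i; case: j => //= H; try exact: rt_refl; try exact: step;
    try by rewrite (ab, ac, bc, ba, cb, ca, ax, bx, cx, ta, tb, tc, tx) in H.
  by apply: rt_trans (step M3_o M3_a I) (step M3_a M3_i I).
- move=> i j; have [/meet_l lij|nij] := boolP (f i <= f j); first by exists i.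
  have [/meet_r lji|nji] := boolP (f j <= f i); first by exists j.
  exists M3_o; case: i j nij nji => -[] /=; rewrite ?lexx ?xa ?xb ?xc ?xt ?at_ ?bt ?ct //;
    by rewrite ?mab ?mac ?mbc // meetC ?mab ?mac ?mbc.
- move=> i j; have [/join_r lij|nij] := boolP (f i <= f j); first by exists j.
  have [/join_l lji|nji] := boolP (f j <= f i); first by exists i.
  exists M3_i; case: i j nij nji => -[] /=; rewrite ?lexx ?xa ?xb ?xc ?xt ?at_ ?bt ?ct //;
    by rewrite ?jab ?jac ?jbc // joinC ?jab ?jac ?jbc.
Qed.

End Sublattices.

(** * Upper covers and join-irreducible elements of a slim planar semimodular lattice *)

Section Planarity.
Local Open Scope ring_scope.
Context {R : realType} {d : Order.disp_t} {L : finTBLatticeType d}.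
Context (D : L -> R * R) (hD : is_diagram D).
Context (sm : semimodular L) (sl : slim L).
Implicit Types (e : R) (x y z u v p q r : L) (s : seq L) (C : {set L}).

(** The middle cover is below the join of the outer ones. By semimodularity the pairwise joins are
    covers of the elements joined, so all three coincide and form [M3]. *)
Lemma no_three_covers x a b c : covers x a -> covers x b -> covers x c ->
  a != b -> b != c -> a != c -> False.
Proof.
have joins a' b' c' : covers x a' -> covers x b' -> covers x c' ->
    a' != b' -> b' != c' -> a' != c' ->
    slope D x a' < slope D x b' -> slope D x b' < slope D x c' -> False.
  move=> ca cb cc nab nbc nac sab sbc.
  have leb := middle_cover_le hD ca cb cc sab sbc.
  have jcov y z : covers x y -> covers x z -> y != z -> covers y (y `|` z)%O.
    move=> cy cz nyz; rewrite joinC; apply: (semimodular_cover_join sm cz) => //.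
      exact: covers_le.
    by apply: contra_neqN nyz => /(covers_incomp cz cy).
  have jab : (a' `|` b' = a' `|` c')%O.
    by apply: (covers_incomp (jcov _ _ ca cb nab) (jcov _ _ ca cc nac)); rewrite leUx leUl.
  have jbc : (b' `|` c' = a' `|` c')%O.
    rewrite joinC [RHS]joinC; apply: (covers_incomp (x := c')).
    - by apply: jcov; rewrite // eq_sym.
    - by apply: jcov; rewrite // eq_sym.
    - by rewrite leUx leUl joinC.
  exact: (M3_sublattice ca cb cc nab nbc nac jab jbc).
move=> ca cb cc nab nbc nac.
have := slope_inj hD ca cb nab; have := slope_inj hD cb cc nbc.
have := slope_inj hD ca cc nac.
rewrite !neq_lt => /orP[ac|ac] /orP[bc|bc] /orP[ab|ab];
  by [apply: (joins a b c)|apply: (joins a c b); rewrite // eq_sym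
     |apply: (joins b a c); rewrite // eq_sym|apply: (joins b c a); rewrite // eq_sym
     |apply: (joins c a b); rewrite // eq_sym|apply: (joins c b a); rewrite // eq_sym
     |lra].
Qed.

Lemma maximal_chain_bot C : maximal_chain C -> \bot%O \in C.
Proof. by case=> _; apply=> x _; rewrite /Order.comparable le0x. Qed.

Lemma maximal_chain_top C : maximal_chain C -> \top%O \in C.
Proof. by case=> _; apply=> x _; rewrite /Order.comparable lex1 orbT. Qed.

(** An element strictly between two consecutive members of the chain would be comparable to the
    whole chain, hence in it by maximality. *)
Lemma maximal_chain_succ C c : maximal_chain C -> c \in C -> c != \top%O ->
  exists2 c', c' \in C & covers c c'.
Proof.
move=> mC cC nct.
have ltct : (c < \top)%O by rewrite lt_neqAle nct lex1.
suff H z : z \in C -> (c < z)%O -> exists2 c', c' \in C & covers c c'.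
  exact: H (maximal_chain_top mC) ltct.
elim/(@lt_wf_ind _ L): z => z IH zC ltcz.
have [ccz|/(coversNP ltcz)[w /andP[ltcw ltwz]]] := boolP (covers c z); first by exists z.
have [/existsP[y /and3P[yC ltcy ltyz]]|] := boolP [exists y, [&& y \in C, c < y & y < z]%O].
  exact: (IH y).
rewrite negb_exists => /forallP nobetween.
have [ch mx] := mC; apply: (IH w) => //; apply: mx => y yC.
have := nobetween y; rewrite yC /= negb_and /Order.comparable.
have /orP[leyc _|lecy] := ch _ _ yC cC.
  by rewrite (le_trans leyc (ltW ltcw)) orbT.
have /orP[leyz|lezy] := ch _ _ yC zC; last by rewrite (le_trans (ltW ltwz) lezy).
rewrite !lt_neqAle lecy leyz !andbT !negbK => /orP[/eqP<-|/eqP->].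
  by rewrite (ltW ltcw) orbT.
by rewrite (ltW ltwz).
Qed.

Lemma maximal_chain_path C c : maximal_chain C -> c \in C ->
  exists s, [/\ path covers c s, last c s = \top%O & {subset s <= C}].
Proof.
move=> mC; elim/(@gt_wf_ind _ L): c => c IH cC.
have [->|nct] := eqVneq c \top%O; first by exists [::].
have [c' c'C ccc'] := maximal_chain_succ mC cC nct.
have [s [ps lasts sC]] := IH c' (covers_lt ccc') c'C.
exists (c' :: s); split=> //=; first by rewrite ccc'.
by move=> z; rewrite inE => /predU1P[->|/sC].
Qed.

Lemma maximal_chain_exit C p : maximal_chain C -> p \notin C ->
  exists c c', [/\ c \in C, c' \in C, covers c c', (c < p)%O & ~~ (c' <= p)%O].
Proof.
move=> mC pC.
suff H c : c \in C -> (c <= p)%O -> exists c c',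
    [/\ c \in C, c' \in C, covers c c', (c < p)%O & ~~ (c' <= p)%O].
  exact: H (maximal_chain_bot mC) (le0x p).
elim/(@gt_wf_ind _ L): c => c IH cC lecp.
have ltcp : (c < p)%O.
  by rewrite lt_neqAle lecp andbT; apply: contraNneq pC => <-.
have nct : c != \top%O by apply: contraTneq ltcp => ->; rewrite lt1x.
have [c' c'C ccc'] := maximal_chain_succ mC cC nct.
have [lec'p|nc'p] := boolP (c' <= p)%O; first exact: IH (covers_lt ccc') c'C lec'p.
by exists c, c'.
Qed.

(** Both boundaries in one notion: [e] is 1 for the left one and -1 for the right one. *)
Definition boundary e C : Prop :=
  maximal_chain C /\ forall u v x, u \in C -> v \in C -> covers u v ->
    level_with (D u) (D v) (D x) -> 0 <= e * cross (D u) (D v) (D x).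

Lemma left_boundary C : left_boundary_chain D C -> boundary 1 C.
Proof.
move=> [mC H]; split=> // u v x uC vC cuv /(H u v x uC vC cuv).
by rewrite mul1r subr_ge0.
Qed.

Lemma right_boundary C : right_boundary_chain D C -> boundary (-1) C.
Proof.
move=> [mC H]; split=> // u v x uC vC cuv /(H u v x uC vC cuv).
by rewrite mulN1r opprB subr_ge0.
Qed.

Lemma boundary_side e C u s x : boundary e C -> path covers u s ->
  last u s = \top%O -> u \in C -> {subset s <= C} -> (D u).2 <= (D x).2 ->
  0 <= e * side D u s (D x).
Proof.
move=> [_ bC]; elim: s u => [|v s IH] u /=; first by rewrite mulr0.
case/andP=> cuv ps lasts uC sC hux.
have vC : v \in C by apply: sC; rewrite mem_head.
case: (leP (D x).2 (D v).2) => [hxv|/ltW hvx]; first by apply: bC; rewrite // /level_with hux.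
by apply: IH => // z zs; apply: sC; rewrite inE zs orbT.
Qed.

Lemma side_cat u s s' x : path covers u s -> (D (last u s)).2 < (D x).2 ->
  side D u (s ++ s') (D x) = side D (last u s) s' (D x).
Proof.
elim: s u => //= v s IH u /andP[cuv ps] hx.
rewrite leNgt (le_lt_trans _ hx) ?IH //.
by apply: diagram_height_le => //; apply: path_covers_le_last; rewrite // mem_head.
Qed.

(** Let [C] leave the elements below [p] between [c] and [c']. The join [r] of [c'] and [q] covers
    [q]. It is compared with a path from [c] through [q] and [p] to the top: [c'] is on the side of
    [C], and climbing from [c'] to [r] never meets the path. *)
Lemma cover_towards_boundary e C p q : e != 0 -> boundary e C ->
  join_irreducible p -> covers q p -> p \notin C ->
  exists r, [/\ covers q r, r != p & e * cross (D q) (D p) (D r) < 0].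
Proof.
move=> e0 bC pJ cqp pC; have [mC _] := bC.
have [c [c' [cC c'C ccc' ltcp nc'p]]] := maximal_chain_exit mC pC.
have lecq := join_irreducible_lower_cover pJ cqp ltcp.
have nc'q : ~~ (c' <= q)%O.
  by apply: contraNN nc'p => /le_trans; apply; apply: covers_le.
have cqr := semimodular_cover_join sm ccc' lecq nc'q.
set r := (c' `|` q)%O in cqr.
have lec'r : (c' <= r)%O by apply: leUl.
have nrp : r != p by apply: contraNneq nc'p => <-.
exists r; split=> //.
have [s0 ps0 lasts0] := covers_path lecq.
have [s1 ps1 lasts1] := covers_path (lex1 p).
have pM : path covers c (s0 ++ p :: s1) by rewrite cat_path ps0 lasts0 /= cqp.
have lastM : last c (s0 ++ p :: s1) = \top%O by rewrite last_cat.
(* The first step of the path after [c]; it is [p] itself when [c] is [q]. *)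
have [m [s' [sE lemp]]] : exists m s', s0 ++ p :: s1 = m :: s' /\ (m <= p)%O.
  case: s0 ps0 lasts0 {pM lastM} => [|m s0'] /=; first by exists p, s1.
  case/andP=> _ ps0 lasts0; exists m, (s0' ++ p :: s1); split=> //.
  apply: le_trans (covers_le cqp).
  by rewrite -lasts0 path_covers_le_last ?mem_head.
rewrite sE in pM lastM.
have ccm : covers c m by case/andP: pM.
have nc'm : c' != m by apply: contraNneq nc'p => ->.
(* With the other sign, [m] would lie beyond the boundary chain [C]. *)
have neg : e * cross (D c) (D m) (D c') < 0.
  rewrite crossC mulrN oppr_lt0 lt_neqAle eq_sym mulf_neq0 //=; last first.
    by apply: cross_covers_neq0; rewrite // eq_sym.
  rewrite leNgt; apply/negP => neg.
  have [sC [psC lastsC sCC]] := maximal_chain_path mC c'C.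
  have pcC : path covers c (c' :: sC) by rewrite /= ccc'.
  have nmc' : m != c' by rewrite eq_sym.
  have := side_start hD ccm pcC lastsC nmc' neg.
  rewrite ltNge (boundary_side bC pcC) //.
    by move=> z; rewrite inE => /predU1P[->|/sCC].
  exact: diagram_height_le (covers_le ccm).
(* Since [r] is higher than [q], only the path from [q] on matters. A vertex of the path between
   [c'] and [r] would be either below [q], hence [c'] too, or above [p], forcing [r] to be [p]. *)
have nr : e * side D q (p :: s1) (D r) < 0.
  have hqr := diagram_height_lt hD (covers_lt cqr).
  rewrite -lasts0 -side_cat ?lasts0 // sE.
  have start := side_start hD ccc' pM lastM nc'm neg.
  apply: (side_le hD pM lastM _ lec'r _ start); first exact: covers_le.
  rewrite -sE => z; rewrite -cat_cons mem_cat => /orP[] zs lec'z lezr.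
    case/negP: nc'q; apply: le_trans lec'z _.
    by rewrite -lasts0; apply: path_covers_le_last.
  case/eqP: nrp; apply/esym/(covers_incomp cqp cqr)/(le_trans _ lezr).
  by move: zs; rewrite inE => /predU1P[->//|/(path_covers_lt ps1)/ltW].
have c0 := cross_covers_neq0 hD cqp cqr nrp.
(* The opposite sign at the start would persist along the path by [side_start] and contradict
   [nr]. *)
rewrite lt_neqAle mulf_neq0 //= leNgt; apply/negP => pos.
have pq : path covers q (p :: s1) by rewrite /= cqp.
have := side_start (e := - e) hD cqr pq lasts1 nrp.
by rewrite !mulNr !oppr_lt0 => /(_ pos)/lt_trans/(_ nr); rewrite ltxx.
Qed.

(** Off both chains, [p] would have a sibling on each side, so its lower cover would have three
    upper covers. *)
Lemma join_irreducible_boundary Cl Cr p : left_boundary_chain D Cl ->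
  right_boundary_chain D Cr -> join_irreducible p -> p \in Cl \/ p \in Cr.
Proof.
move=> /left_boundary bl /right_boundary br pJ.
have [pl|pl] := boolP (p \in Cl); first by left.
have [pr|pr] := boolP (p \in Cr); first by right.
have ltp : (\bot < p)%O by rewrite lt0x; case: pJ.
have [q cqp _] := ex_lower_cover ltp.
have [r [cqr nrp Hr]] := cover_towards_boundary (oner_neq0 _) bl pJ cqp pl.
have [r' [cqr' nr'p Hr']] : exists r, [/\ covers q r, r != p & -1 * cross (D q) (D p) (D r) < 0].
  by apply: cover_towards_boundary br pJ cqp pr; rewrite oppr_eq0 oner_neq0.
exfalso; apply: (no_three_covers cqr cqp cqr'); rewrite // 1?eq_sym //.
by apply: contraTneq Hr => <-; rewrite mul1r -leNgt; lra.
Qed.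

End Planarity.

(** * From the corners to coordinates in two chains *)

Section Corners.
Local Open Scope order_scope.
Context {d : Order.disp_t} {L : finTBLatticeType d}.
Implicit Types (a b c p q x y z u v w : L).

(** The order-theoretic content of rectangular corners: symmetric in [a] and [b] and free of any
    diagram. *)
Definition corner_pair a b : Prop :=
  [/\ complementary a b, proper_doubly_irreducible a, proper_doubly_irreducible b
    & forall x, proper_doubly_irreducible x -> x = a \/ x = b].

Lemma corner_pairC a b : corner_pair a b -> corner_pair b a.
Proof.
case=> [[m j] ha hb H]; split=> //; first by split; rewrite 1?meetC 1?joinC.
by move=> x /H[]; [right|left].
Qed.

Definition chain_below c : Prop :=
  forall x y, x <= c -> y <= c -> x <= y \/ y <= x.

(** With these properties, [psi a b] is an order embedding into a product of two chains. *)
Definition grid_pair a b : Prop :=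
  [/\ chain_below a, chain_below b
    & forall x, x = (x `&` a) `|` (x `&` b)].

Lemma grid_pairC a b : grid_pair a b -> grid_pair b a.
Proof. by case=> ha hb H; split=> // x; rewrite joinC. Qed.

Context (sm : semimodular L).
Context (n3 : forall x a b c, covers x a -> covers x b -> covers x c ->
  a != b -> b != c -> a != c -> False).

(** Two covers of [p] that are not join-irreducible would each be the join of [p] with another cover
    of its lower cover [q]. These would be distinct, and [q] would have three covers. *)
Lemma join_irreducible_cover p : join_irreducible p -> p != \top ->
  meet_irreducible p \/ exists2 v, covers p v & join_irreducible v.
Proof.
move=> pJ npt.
have [/existsP[v /andP[cpv /jirrP vJ]]|] := boolP [exists v, covers p v && jirr v].
  by right; exists v.
rewrite negb_exists => /forallP noJ; left.
apply: unique_upper_cover_meet_irreducible => // v v' cpv cpv'.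
have [//|nvv'] := eqVneq v v'.
have ltp : \bot < p by rewrite lt0x; case: pJ.
have [q cqp _] := ex_lower_cover ltp.
have [r [cqr nrp rE]] : exists r, [/\ covers q r, r != p & r `|` p = v].
  by apply: non_join_irreducible_cover; rewrite //; have := noJ v; rewrite cpv.
have [r' [cqr' nr'p r'E]] : exists r, [/\ covers q r, r != p & r `|` p = v'].
  by apply: non_join_irreducible_cover; rewrite //; have := noJ v'; rewrite cpv'.
exfalso; apply: (n3 cqr cqp cqr'); rewrite // 1?eq_sym //.
by apply: contraNneq nvv' => E; rewrite -rE -r'E E.
Qed.

(** Climbing through join-irreducible covers stops at a doubly irreducible element, which is a
    corner. *)
Lemma join_irreducible_below_corner a b p : corner_pair a b ->
  join_irreducible p -> p <= a \/ p <= b.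
Proof.
case=> [[_ jab] [_ nat _] [_ nbt _] H].
elim/(@gt_wf_ind _ L): p => p IH pJ.
(* The top is the join of the corners, both different from it. *)
have npt : p != \top.
  apply/eqP => pt; case: pJ => _ /(_ a b); rewrite jab pt.
  by case=> // E; [case/eqP: nat|case/eqP: nbt].
case: (join_irreducible_cover pJ npt) => [pM|[v cpv vJ]].
  have [|->|->] := H p; [|by left|by right].
  by split=> //; case: pJ.
have lepv := covers_le cpv.
by have [leva|levb] := IH v (covers_lt cpv) vJ; [left|right]; apply: le_trans lepv _.
Qed.

(** A join-irreducible element below [a] is comparable to everything below [a], by downward
    induction from [a] through join-irreducible covers. This suffices, since a failure of [x <= y]
    is witnessed by a join-irreducible element. *)
Lemma corner_chain_below a b : corner_pair a b -> chain_below a.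
Proof.
move=> cab; have [[mab _] [na0 nat [aJ aM]] [nb0 nbt _] H] := cab.
have JP p z : join_irreducible p -> p <= a -> z <= a -> z <= p \/ p <= z.
  elim/(@gt_wf_ind _ L): p z => p IH z pJ lepa leza.
  have npt : p != \top.
    by apply: contraNneq nat => pt; rewrite -le1x -pt.
  case: (join_irreducible_cover pJ npt) => [pM|[v cpv vJ]].
    have [|->|pb] := H p; [by split=> //; case: pJ|by left|].
    by case/eqP: nb0; rewrite -mab; apply/esym/meet_r; rewrite -pb.
  have lepv := covers_le cpv.
  have leva : v <= a.
    have [//|levb] := join_irreducible_below_corner cab vJ.
    case: pJ => /eqP[]; apply/eqP; rewrite -lex0 -mab lexI lepa.
    exact: le_trans levb.
  have [|levz] := IH v (covers_lt cpv) z vJ leva leza.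
    rewrite le_eqVlt => /predU1P[->|ltzv]; first by right.
    by left; apply: join_irreducible_lower_cover vJ cpv ltzv.
  by right; apply: le_trans lepv levz.
move=> x y lexa leya; have [lexy|nxy] := boolP (x <= y); first by left.
have [p [pJ lepx npy]] := ex_join_irreducible nxy.
have [leyp|lepy] := JP p y pJ (le_trans lepx lexa) leya.
  by right; apply: le_trans leyp lepx.
by rewrite lepy in npy.
Qed.

Lemma corner_pair_grid a b : corner_pair a b -> grid_pair a b.
Proof.
move=> cab; split; first exact: corner_chain_below cab.
  exact: corner_chain_below (corner_pairC cab).
move=> x; apply/le_anti; rewrite leUx !leIl !andbT.
apply/idPn => /ex_join_irreducible[p [pJ lepx]]; apply/negP; rewrite negbK.
have [lepa|lepb] := join_irreducible_below_corner cab pJ.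
  by apply: lexUl; rewrite lexI lepx.
by apply: lexUr; rewrite lexI lepx.
Qed.

End Corners.

(** * The corners of a diagram form a corner pair *)

Section RectangularCorners.
Context {R : realType} {d : Order.disp_t} {L : finTBLatticeType d}.

Lemma rectangular_corner_pair (D : L -> R * R) lc rc : is_diagram D ->
  semimodular L -> slim L -> rectangular_corners D lc rc -> corner_pair lc rc.
Proof.
move=> hD sm sl [[Cl bl [_ hl ul]] [Cr br [_ hr ur]] comp]; split=> // x hx.
have [xl|xr] : x \in Cl \/ x \in Cr.
  by apply: (join_irreducible_boundary hD sm sl bl br); case: hx => _ _ [].
- by left; apply: ul.
- by right; apply: ur.
Qed.

End RectangularCorners.

(** * The order read off from the two coordinates *)

Section Grid.
Local Open Scope order_scope.
Context {d : Order.disp_t} {L : finTBLatticeType d}.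
Context {a b : L} (gab : grid_pair a b).
Implicit Types (x y z u v w p q : L).

Lemma le_grid x y : (x <= y) = (x `&` a <= y `&` a) && (x `&` b <= y `&` b).
Proof.
apply/idP/andP => [lexy|[lea leb]]; first by rewrite !leI2.
by case: gab => _ _ H; rewrite (H x) (H y) leU2.
Qed.

Lemma grid_total_l x y : (x `&` a <= y `&` a) || (y `&` a <= x `&` a).
Proof. by case: gab => /(_ (x `&` a) (y `&` a))[]; rewrite ?leIr // => ->; rewrite ?orbT. Qed.

Lemma grid_total_r x y : (x `&` b <= y `&` b) || (y `&` b <= x `&` b).
Proof. by case: gab => _ /(_ (x `&` b) (y `&` b))[]; rewrite ?leIr // => ->; rewrite ?orbT. Qed.

Lemma grid_inj x y : x `&` a = y `&` a -> x `&` b = y `&` b -> x = y.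
Proof. by case: gab => _ _ H ea eb; rewrite (H x) (H y) ea eb. Qed.

End Grid.

(* [S7] as a meet-subsemilattice of the product of two three-element chains. *)
Definition S7_l (i : S7) : nat :=
  match i with
  | S7_o | S7_mb | S7_b => 0 | S7_ma | S7_m => 1 | S7_a | S7_t => 2
  end.

Definition S7_r (i : S7) : nat :=
  match i with
  | S7_o | S7_ma | S7_a => 0 | S7_mb | S7_m => 1 | S7_b | S7_t => 2
  end.

Lemma S7_leP i j : clos_refl_trans S7 S7_cov i j <->
  (S7_l i <= S7_l j)%N && (S7_r i <= S7_r j)%N.
Proof.
split.
  elim=> [x y|x|x y z _ /andP[l1 r1] _ /andP[l2 r2]]; first by case: x; case: y.
    by rewrite !leqnn.
  by rewrite (leq_trans l1 l2) (leq_trans r1 r2).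
have step k l : S7_cov k l -> clos_refl_trans S7 S7_cov k l by apply: rt_step.
have oa := rt_trans _ _ _ _ _ (step S7_o S7_ma I) (step S7_ma S7_a I).
have om := rt_trans _ _ _ _ _ (step S7_o S7_ma I) (step S7_ma S7_m I).
have ob := rt_trans _ _ _ _ _ (step S7_o S7_mb I) (step S7_mb S7_b I).
have mat := rt_trans _ _ _ _ _ (step S7_ma S7_m I) (step S7_m S7_t I).
have mbt := rt_trans _ _ _ _ _ (step S7_mb S7_m I) (step S7_m S7_t I).
have ot := rt_trans _ _ _ _ _ om (step S7_m S7_t I).
by case: i; case: j => //= _; first [exact: rt_refl | exact: step].
Qed.

(** * Middle edges of peak sublattices are the edges that change both coordinates *)

Section PeakEdges.
Local Open Scope order_scope.
Context {d : Order.disp_t} {L : finTBLatticeType d}.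
Implicit Types (a b x y z u v w p q : L).

(** If the middle and the top had the same meet with [a], then the meets of both [S7] corners with
    [b] would fail to be below that of the middle. But the smaller of the two is below the meet of
    the [S7] corners, hence below the middle. *)
Lemma peak_middle_edge_neq a b x y : grid_pair a b ->
  peak_middle_edge x y -> x `&` a != y `&` a.
Proof.
move=> gab [f [[fle fmeet _] [cat cmt cbt] -> ->]].
have fleE i j : (f i <= f j) = (S7_l i <= S7_l j)%N && (S7_r i <= S7_r j)%N.
  by apply/idP/idP; rewrite fle S7_leP.
apply/eqP => mt.
have lt_r i : ~~ (f i <= f S7_m) -> f i <= f S7_t ->
    f i `&` b <= f S7_m `&` b = false.
  move=> + leit; rewrite (le_grid gab (f i) (f S7_m)) mt leI2 //=.
  by move/negbTE.
have rma := lt_r S7_a; have rmb := lt_r S7_b; rewrite !fleE /= in rma rmb.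
have [k kE] := fmeet S7_a S7_b.
have kE' : f k <= f S7_m.
  have : (f k <= f S7_a) && (f k <= f S7_b) by rewrite -lexI kE.
  by rewrite !fleE; case: k {kE}.
have kb := leI2 kE' (lexx b); rewrite kE in kb.
have [ab|ba] := orP (grid_total_r gab (f S7_a) (f S7_b)).
  move/idP: (rma isT isT); apply; apply: le_trans kb.
  by rewrite !lexI leIl leIr (le_trans ab (leIl _ _)).
move/idP: (rmb isT isT); apply; apply: le_trans kb.
by rewrite !lexI leIl leIr (le_trans ba (leIl _ _)).
Qed.

(** Take a lower cover [p] of [y] above the meet of [y] and [a]. If it were also as large as [x] in
    the other coordinate, it would be above [x], hence equal to it. This [p] serves as a corner of
    the peak. *)
Lemma ex_lower_cover_same_meet a b x y : grid_pair a b -> a `&` b = \bot ->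
  covers x y -> x `&` a != y `&` a -> x `&` b != y `&` b ->
  exists p, [/\ covers p y, p `&` a = y `&` a, ~~ (x `&` b <= p `&` b)
    & ~~ (y `&` b <= x `&` b)].
Proof.
move=> gab mab cxy na nb.
have lexy := covers_le cxy.
have nyx : ~~ (y `&` b <= x `&` b).
  by apply: contraNN nb => leyx; rewrite eq_le leyx (leI2 lexy (lexx b)).
have lty : y `&` a < y.
  rewrite lt_neqAle leIl andbT; apply: contraNneq nyx => <-.
  by rewrite -meetA mab meetx0 le0x.
have [p cpy lep] := ex_lower_cover lty.
have pE : p `&` a = y `&` a.
  by apply/le_anti; rewrite (leI2 (covers_le cpy) (lexx a)) lexI lep leIr.
exists p; split=> //; apply: contraNN na => lexp.
have xp : x = p.
  by apply: (lower_covers_incomp cxy cpy); rewrite (le_grid gab) lexp pE (leI2 lexy (lexx a)).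
by rewrite xp pE.
Qed.

Lemma neq_peak_middle_edge a b x y : grid_pair a b -> a `&` b = \bot ->
  covers x y -> x `&` a != y `&` a -> x `&` b != y `&` b ->
  peak_middle_edge x y.
Proof.
move=> gab mab cxy na nb.
have [p [cpy pa npb nyxb]] := ex_lower_cover_same_meet gab mab cxy na nb.
have [q [cqy qb nqa nyxa]] : exists q, [/\ covers q y, q `&` b = y `&` b,
    ~~ (x `&` a <= q `&` a) & ~~ (y `&` a <= x `&` a)].
  by apply: ex_lower_cover_same_meet => //; [apply: grid_pairC|rewrite meetC].
have lexy := covers_le cxy; have lepy := covers_le cpy; have leqy := covers_le cqy.
pose f i := match i with S7_o => p `&` q | S7_ma => p `&` x | S7_mb => x `&` q
  | S7_a => p | S7_b => q | S7_m => x | S7_t => y end.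
(* The three values of each coordinate on the peak, indexed by [S7_l] and [S7_r]; once they are
   strictly increasing, the order of [S7] follows. *)
pose A n := match n with 0 => q `&` a | 1 => x `&` a | _ => y `&` a end.
pose B n := match n with 0 => p `&` b | 1 => x `&` b | _ => y `&` b end.
have qxa : q `&` a <= x `&` a.
  by have := grid_total_l gab x q; rewrite (negbTE nqa).
have pxb : p `&` b <= x `&` b.
  by have := grid_total_r gab x p; rewrite (negbTE npb).
have xya : x `&` a <= y `&` a by apply: leI2.
have xyb : x `&` b <= y `&` b by apply: leI2.
have qya := le_trans qxa xya; have pyb := le_trans pxb xyb.
have nqya : ~~ (y `&` a <= q `&` a) by apply: contraNN nqa; apply: le_trans.
have npyb : ~~ (y `&` b <= p `&` b) by apply: contraNN npb; apply: le_trans.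
have meetE u v c : u `&` v `&` c = (u `&` c) `&` (v `&` c).
  by rewrite meetACA meetxx.
have fA i : f i `&` a = A (S7_l i).
  case: i => //=; rewrite meetE ?pa.
  - exact: meet_r.
  - exact: meet_r.
  - exact: meet_r.
have fB i : f i `&` b = B (S7_r i).
  case: i => //=; rewrite meetE ?qb.
  - exact: meet_l.
  - exact: meet_l.
  - exact: meet_l.
have Ale m n : (m < 3)%N -> (n < 3)%N -> (A m <= A n) = (m <= n)%N.
  case: m => [|[|[|//]]]; case: n => [|[|[|//]]] _ _ /=;
    by rewrite ?lexx ?qxa ?xya ?qya ?(negbTE nqa) ?(negbTE nyxa) ?(negbTE nqya).
have Ble m n : (m < 3)%N -> (n < 3)%N -> (B m <= B n) = (m <= n)%N.
  case: m => [|[|[|//]]]; case: n => [|[|[|//]]] _ _ /=;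
    by rewrite ?lexx ?pxb ?xyb ?pyb ?(negbTE npb) ?(negbTE nyxb) ?(negbTE npyb).
have fle i j : (f i <= f j) = (S7_l i <= S7_l j)%N && (S7_r i <= S7_r j)%N.
  rewrite (le_grid gab) !fA !fB.
  by congr (_ && _); [apply: Ale|apply: Ble]; case: i; case: j.
have jpx : p `|` x = y.
  by apply: covers_join => //; apply: contraNneq npb => <-.
have jpq : p `|` q = y.
  by apply: covers_join => //; apply: contraNneq npyb => ->; rewrite qb.
have jxq : x `|` q = y.
  by apply: covers_join => //; apply: contraNneq nqa => <-.
have jm : (p `&` x) `|` (x `&` q) = x.
  apply/le_anti; rewrite leUx leIl leIr /=.
  have [_ _ /(_ x) {1}->] := gab; apply: leU2; rewrite lexI.
    by rewrite leIl andbT; apply: le_trans (leIl p a); rewrite pa.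
  by rewrite leIl /=; apply: le_trans (leIl q b); rewrite qb.
have top_join u c : u <= y -> covers c y -> ~~ (u <= c) -> u `|` c = y.
  move=> leuy ccy nuc; have [| |E|//] := covers_between ccy (z := u `|` c).
  - exact: leUr.
  - by rewrite leUx leuy covers_le.
  - by case/negP: nuc; rewrite -E leUl.
exists f; split=> //; split=> //.
- by move=> i j; rewrite fle; apply: iff_sym; apply: S7_leP.
- move=> i j; have [/meet_l lij|nij] := boolP (f i <= f j); first by exists i.
  have [/meet_r lji|nji] := boolP (f j <= f i); first by exists j.
  (* Meets are coordinatewise minima, and for incomparable elements of [S7] the pair of minima
     belongs to an element of [S7]. *)
  have [k [kl kr]] : exists k, S7_l k = minn (S7_l i) (S7_l j) /\
      S7_r k = minn (S7_r i) (S7_r j).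
    move: nij nji; rewrite !fle; case: i; case: j => //= _ _;
      by [exists S7_o|exists S7_ma|exists S7_mb].
  exists k; apply/le_anti/andP; split.
    by rewrite lexI !fle kl kr !geq_minl !geq_minr.
  rewrite (le_grid gab) (meetE (f i) (f j) a) (meetE (f i) (f j) b) !fA !fB kl kr.
  by rewrite /minn; case: ifP => _; case: ifP => _; rewrite ?leIl ?leIr.
- move=> i j; have [/join_r lij|nij] := boolP (f i <= f j); first by exists j.
  have [/join_l lji|nji] := boolP (f j <= f i); first by exists i.
  (* An incomparable pair containing a lower cover of the top joins to the top; the only other
     incomparable pair is [S7_ma] and [S7_mb], handled by [jm]. *)
  have top k l : S7_cov l S7_t -> ~~ (f k <= f l) -> f S7_t = f k `|` f l.
    move=> cl nkl; apply/esym/top_join => //; last by case: l cl {nkl}.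
    by rewrite -[y]/(f S7_t) fle; case: k {nkl}.
  have {}jm : f S7_m = f S7_ma `|` f S7_mb by [].
  rewrite !fle in nij nji; clearbody f; clear -jm top fle nij nji.
  have {}top k l : S7_cov l S7_t -> ~~ ((S7_l k <= S7_l l) && (S7_r k <= S7_r l))%N ->
    exists m, f m = f k `|` f l.
    by move=> cl nkl; exists S7_t; apply: top; rewrite ?fle.
  have topC k l : S7_cov k S7_t -> ~~ ((S7_l l <= S7_l k) && (S7_r l <= S7_r k))%N ->
    exists m, f m = f k `|` f l.
    by move=> ck nlk; rewrite joinC; apply: top.
  case: i nij nji; case: j => //= _ _;
    by [apply: top|apply: topC|exists S7_m|exists S7_m; rewrite joinC].
Qed.

End PeakEdges.

(** * Planarity of drawings given by a meet-embedding into a product of two chains *)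

Section ProductCoordinates.
Local Open Scope ring_scope.
Context {R : realType} {d : Order.disp_t} {L : finTBLatticeType d}.
Context {D : L -> R * R} {l r : L -> R}.
Context (leE : forall x y, (x <= y)%O = (l x <= l y) && (r x <= r y)).
Context (DE : forall x, D x = (r x - l x, r x + l x)).
Implicit Types (x y z u v : L) (p q : R * R) (t : R).

Lemma on_segment_coordinates x y q : on_segment (D x) (D y) q ->
  exists t, [/\ 0 <= t <= 1, (q.2 - q.1) / 2 = l x + t * (l y - l x)
    & (q.1 + q.2) / 2 = r x + t * (r y - r x)].
Proof.
by case=> t t01 ->; exists t; split=> //; rewrite !DE /=; field.
Qed.

Lemma coordinates_inj x y : l x = l y -> r x = r y -> x = y.
Proof. by move=> el er; apply/le_anti; rewrite !leE el er !lexx. Qed.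

Lemma point_eq x q : (q.2 - q.1) / 2 = l x -> (q.1 + q.2) / 2 = r x -> q = D x.
Proof.
by case: q => q1 q2 /= el er; rewrite DE -el -er; congr (_, _); field.
Qed.

Lemma affine_between (a b t : R) : 0 <= t <= 1 -> a <= b ->
  a <= a + t * (b - a) <= b.
Proof.
move=> /andP[t0 t1] ab.
have h0 : 0 <= t * (b - a) by rewrite mulr_ge0 ?subr_ge0.
have h1 : 0 <= (1 - t) * (b - a) by rewrite mulr_ge0 ?subr_ge0.
by apply/andP; split; lra.
Qed.

Lemma scaled_le (p p' a b : R) : 0 < p -> (p' - p) * b <= 0 -> p * a = p' * b ->
  a <= b.
Proof.
move=> p0 pb E; rewrite -(ler_pM2l p0) E; lra.
Qed.

(** If both parameters were positive, the two edges would be proportional as vectors from [z], with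
    coordinates of one sign, and [x] and [u] would be comparable. *)
Lemma common_end (z x u : L) (p p' : R) :
  ~~ (x <= u)%O -> ~~ (u <= x)%O ->
  ((z <= x) && (z <= u))%O || ((x <= z) && (u <= z))%O -> 0 <= p -> 0 <= p' ->
  p * (l x - l z) = p' * (l u - l z) -> p * (r x - r z) = p' * (r u - r z) ->
  p = 0 \/ p' = 0.
Proof.
move=> nxu nux side p0 p'0 El Er.
have [->|np] := eqVneq p 0; first by left.
have [->|np'] := eqVneq p' 0; first by right.
have {np p0} p0 : 0 < p by rewrite lt_neqAle eq_sym np.
have {np' p'0} p'0 : 0 < p' by rewrite lt_neqAle eq_sym np'.
have le_of (v w : L) (s t : R) : 0 < s ->
    (t - s) * (l w - l z) <= 0 -> (t - s) * (r w - r z) <= 0 ->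
    s * (l v - l z) = t * (l w - l z) -> s * (r v - r z) = t * (r w - r z) ->
    (v <= w)%O.
  move=> s0 hl hr /(scaled_le s0 hl) + /(scaled_le s0 hr).
  by rewrite leE !lerD2r => -> ->.
exfalso; case/orP: side; rewrite !leE => /andP[/andP[a1 a2] /andP[b1 b2]];
  have [le_pp'|/ltW le_p'p] := leP p p'.
- by case/negP: nux; apply: (le_of _ _ p' p); rewrite // mulr_le0_ge0 ?subr_le0 ?subr_ge0.
- by case/negP: nxu; apply: (le_of _ _ p p'); rewrite // mulr_le0_ge0 ?subr_le0 ?subr_ge0.
- by case/negP: nxu; apply: (le_of _ _ p p'); rewrite // mulr_ge0_le0 ?subr_le0 ?subr_ge0.
- by case/negP: nux; apply: (le_of _ _ p' p); rewrite // mulr_ge0_le0 ?subr_le0 ?subr_ge0.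
Qed.

Lemma covers_coordinates x y : covers x y -> [/\ l x <= l y, r x <= r y
  & l x + r x < l y + r y].
Proof.
move/covers_lt; rewrite lt_neqAle leE => /and3P[nxy hl hr]; split=> //.
rewrite lt_neqAle lerD // andbT; apply: contraNneq nxy => E.
by apply/eqP/coordinates_inj; lra.
Qed.

Lemma coordinates_diagram : is_diagram D.
Proof.
split.
- move=> x y; rewrite !DE => -[e1 e2]; apply: coordinates_inj; lra.
- by move=> x y /covers_coordinates[_ _]; rewrite !DE /=; lra.
move=> x y u v q cxy cuv ne.
move=> /on_segment_coordinates[t [t01 El Er]].
move=> /on_segment_coordinates[t' [t'01 El' Er']].
have [lxy rxy _] := covers_coordinates cxy.
have [luv ruv _] := covers_coordinates cuv.
have /andP[l1 l2] := affine_between t01 lxy; have /andP[r1 r2] := affine_between t01 rxy.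
have /andP[l1' l2'] := affine_between t'01 luv; have /andP[r1' r2'] := affine_between t'01 ruv.
rewrite -El in l1 l2; rewrite -Er in r1 r2; rewrite -El' in l1' l2'; rewrite -Er' in r1' r2'.
have lexv : (x <= v)%O by rewrite leE (le_trans l1 l2') (le_trans r1 r2').
have leuy : (u <= y)%O by rewrite leE (le_trans l1' l2) (le_trans r1' r2).
(* The meet of the tops lies on both edges, so it is an end of each of them. *)
have my : (y `&` v)%O = x \/ (y `&` v)%O = y.
  by apply: (covers_between cxy _ (leIl _ _)); rewrite lexI lexv covers_le.
have mv : (y `&` v)%O = u \/ (y `&` v)%O = v.
  by apply: (covers_between cuv _ (leIr _ _)); rewrite lexI leuy covers_le.
case: my mv => -> [] E; subst.
(* Common bottom: the tops are incomparable, so the meeting point is at that bottom. *)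
- have nyv : y != v by apply: contra_notN ne => /eqP->.
  case/andP: t01 => t0 _; case/andP: t'01 => t'0 _.
  have [|||||||t00|t'00] := @common_end u y v t t';
    rewrite ?(covers_le cxy) ?(covers_le cuv) //.
  + by apply: contraNN nyv => /(covers_incomp cxy cuv)->.
  + by apply: contraNN nyv => /(covers_incomp cuv cxy)->.
  + lra.
  + lra.
  + exists u; split; [by left|by left|].
    by apply: point_eq; [rewrite El t00|rewrite Er t00]; lra.
  + exists u; split; [by left|by left|].
    by apply: point_eq; [rewrite El' t'00|rewrite Er' t'00]; lra.
(* One edge starts where the other ends, and the coordinates of the meeting point are squeezed
   there. *)
- exists v; split; [by left|by right|].
  by apply: point_eq; apply/le_anti/andP.
- exists u; split; [by right|by left|].
  by apply: point_eq; apply/le_anti/andP.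
(* Common top: dual to the first case, with parameters measured from the top. *)
- have nxu : x != u by apply: contra_notN ne => /eqP->.
  case/andP: t01 => _ t1; case/andP: t'01 => _ t'1.
  have [|||||||t00|t'00] := @common_end v x u (1 - t) (1 - t');
    rewrite ?(covers_le cxy) ?(covers_le cuv) ?orbT ?subr_ge0 //.
  + by apply: contraNN nxu => /(lower_covers_incomp cxy cuv)->.
  + by apply: contraNN nxu => /(lower_covers_incomp cuv cxy)->.
  + lra.
  + lra.
  + have {}t00 : t = 1 by lra.
    exists v; split; [by right|by right|].
    by apply: point_eq; [rewrite El t00|rewrite Er t00]; lra.
  + have {}t'00 : t' = 1 by lra.
    exists v; split; [by right|by right|].
    by apply: point_eq; [rewrite El' t'00|rewrite Er' t'00]; lra.
Qed.

End ProductCoordinates.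

(** * Natural diagrams are C1-diagrams, with the expected corners *)

Section NaturalDiagrams.
Local Open Scope ring_scope.
Context {R : realType} {d : Order.disp_t} {L : finTBLatticeType d}.
Implicit Types (D : L -> R * R) (lam rho : L -> R) (x y z u v : L).

Lemma chain_below_mono c lam x y : chain_below c ->
  strictly_increasing_below c lam -> (x <= c)%O -> (y <= c)%O ->
  (lam x <= lam y) = (x <= y)%O.
Proof.
move=> ch inc xc yc; apply/idP/idP => [|].
  move=> le; have [//|] := ch x y xc yc; rewrite le_eqVlt => /predU1P[->//|ltyx].
  by move: (inc _ _ ltyx xc); rewrite ltNge le.
by rewrite le_eqVlt => /predU1P[->//|/inc/(_ yc)/ltW].
Qed.

Context {a b : L} {lam rho : L -> R} {D : L -> R * R}.
Context (gab : grid_pair a b) (mab : (a `&` b = \bot)%O).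
Context (hlam : strictly_increasing_below a lam).
Context (hrho : strictly_increasing_below b rho).
Context (DE : forall x, D x = grid_point lam rho (psi a b x)).

Let l x := lam (x `&` a)%O.
Let r x := rho (x `&` b)%O.

Lemma natural_leE_l x y : (l x <= l y) = (x `&` a <= y `&` a)%O.
Proof. by apply: chain_below_mono hlam _ _; rewrite ?leIr //; case: gab. Qed.

Lemma natural_leE_r x y : (r x <= r y) = (x `&` b <= y `&` b)%O.
Proof. by apply: chain_below_mono hrho _ _; rewrite ?leIr //; case: gab. Qed.

Lemma natural_leE x y : (x <= y)%O = (l x <= l y) && (r x <= r y).
Proof. by rewrite natural_leE_l natural_leE_r; apply: le_grid. Qed.

(** An edge that keeps one coordinate is normal and no middle edge of a peak; an edge that changes
    both is steep and is such a middle edge. *)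
Lemma natural_diagram_C1 : C1_diagram D.
Proof.
split; first exact: (coordinates_diagram natural_leE DE).
move=> x y cxy; have [lxy rxy _] := covers_coordinates natural_leE cxy.
rewrite /normal_edge /steep_edge !DE /= -!/(l _) -!/(r _).
have [ea|na] := eqVneq (x `&` a)%O (y `&` a)%O.
  have el : l x = l y by rewrite /l ea.
  split=> [/(peak_middle_edge_neq gab)|_]; first by rewrite ea eqxx.
  by rewrite el ger0_norm; lra.
have [eb|nb] := eqVneq (x `&` b)%O (y `&` b)%O.
  have er : r x = r y by rewrite /r eb.
  split=> [/(peak_middle_edge_neq (grid_pairC gab))|_]; first by rewrite eb eqxx.
  by rewrite er ler0_norm; lra.
split=> [_|[]]; last exact: neq_peak_middle_edge gab mab cxy na nb.
have lxy' : l x < l y.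
  rewrite ltNge natural_leE_l; apply: contraNN na => le.
  by rewrite eq_le le andbT -natural_leE_l.
have rxy' : r x < r y.
  rewrite ltNge natural_leE_r; apply: contraNN nb => le.
  by rewrite eq_le le andbT -natural_leE_r.
by rewrite ltr_norml; apply/andP; split; lra.
Qed.

(** Elements above [c] differ only in their meets with [c'], which form a chain. This will be the
    boundary chain through the corner [c]. *)
Lemma maximal_chain_through (c c' : L) : grid_pair c c' ->
  maximal_chain [set x : L | (x <= c)%O || (c <= x)%O].
Proof.
move=> gcc; split=> [x y|z]; last first.
  by move/(_ c); rewrite !inE lexx /= => /(_ isT).
rewrite !inE /Order.comparable => /orP[xc|cx] /orP[yc|cy].
- by case: gcc => /(_ _ _ xc yc)[]->; rewrite ?orbT.
- by rewrite (le_trans xc cy).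
- by rewrite (le_trans yc cx) orbT.
- have ex := meet_r cx; have ey := meet_r cy.
  by rewrite (le_grid gcc x) (le_grid gcc y) ex ey lexx /=; apply: grid_total_r gcc _ _.
Qed.

Lemma covers_through (c u v : L) : covers u v ->
  u \in [set x : L | (x <= c)%O || (c <= x)%O] ->
  v \in [set x : L | (x <= c)%O || (c <= x)%O] -> (v <= c)%O \/ (c <= u)%O.
Proof.
move=> cuv; rewrite !inE => /orP[uc|]; last by right.
case/orP=> [|cv]; first by left.
by have [->|->] := covers_between cuv uc cv; [right|left].
Qed.

(** On the chain through [a], the coordinate [r] is minimal below [a] and [l] is maximal above [a],
    so nothing lies to its left; symmetrically for [b]. *)
Lemma natural_rectangular_corners : corner_pair a b -> rectangular_corners D a b.
Proof.
case=> comp pa pb H; have [_ jab] := comp.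
have only (c c' : L) : grid_pair c c' -> proper_doubly_irreducible c ->
    proper_doubly_irreducible c' -> (c `&` c' = \bot)%O -> (c `|` c' = \top)%O ->
    (forall x, proper_doubly_irreducible x -> x = c \/ x = c') ->
    only_proper_doubly_irreducible [set x : L | (x <= c)%O || (c <= x)%O] c.
  move=> _ hc [n0 nt _] m j Hx; split=> //; first by rewrite inE lexx.
  (* The other corner is off this chain: comparable to its complement [c], it would be a bound. *)
  move=> x xC /Hx[//|xE]; move: xC; rewrite inE xE => /orP[le|le].
    by case/eqP: n0; rewrite -m meet_r.
  by case/eqP: nt; rewrite -j join_r.
have lmin x u : (u <= b)%O -> l u <= l x.
  move=> ub; rewrite natural_leE_l; apply: le_trans (le0x _).
  by rewrite -mab meetC leI2.
have rmin x u : (u <= a)%O -> r u <= r x.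
  move=> ua; rewrite natural_leE_r; apply: le_trans (le0x _).
  by rewrite -mab leI2.
have lmax x u : (a <= u)%O -> l x <= l u.
  by move=> au; rewrite natural_leE_l (meet_r au) leIr.
have rmax x u : (b <= u)%O -> r x <= r u.
  by move=> bu; rewrite natural_leE_r (meet_r bu) leIr.
split=> //.
- exists [set x : L | (x <= a)%O || (a <= x)%O].
    split; first exact: maximal_chain_through gab.
    move=> u v x uC vC cuv _; rewrite /weakly_right_of !DE /= -!/(l _) -!/(r _).
    have [luv ruv _] := covers_coordinates natural_leE cuv.
    have [va|au] := covers_through cuv uC vC.
      have er : r v = r u.
        by apply/le_anti; rewrite ruv rmin.
      have h : 0 <= (l v - l u) * (r x - r u).
        by rewrite mulr_ge0 // subr_ge0 // -er rmin.
      by rewrite er; lra.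
    have el : l v = l u by apply/le_anti; rewrite luv lmax.
    have h : 0 <= (r v - r u) * (l u - l x).
      by rewrite mulr_ge0 // subr_ge0 // lmax.
    by rewrite el; lra.
  exact: (only a b).
exists [set x : L | (x <= b)%O || (b <= x)%O].
  split; first exact: maximal_chain_through (grid_pairC gab).
  move=> u v x uC vC cuv _; rewrite /weakly_left_of !DE /= -!/(l _) -!/(r _).
  have [luv ruv _] := covers_coordinates natural_leE cuv.
  have [vb|bu] := covers_through cuv uC vC.
    have el : l v = l u by apply/le_anti; rewrite luv lmin.
    have h : 0 <= (r v - r u) * (l x - l u).
      by rewrite mulr_ge0 // subr_ge0 // -el lmin.
    by rewrite el; lra.
  have er : r v = r u by apply/le_anti; rewrite ruv rmax.
  have h : 0 <= (l v - l u) * (r u - r x).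
    by rewrite mulr_ge0 // subr_ge0 // rmax.
  by rewrite er; lra.
apply: (only b a) => //; [exact: grid_pairC|by rewrite meetC|by rewrite joinC|].
by move=> x /H[]; [right|left].
Qed.

End NaturalDiagrams.

(** * Transport of edge directions in a C1-diagram *)

Section Orientation.
Local Open Scope ring_scope.
Context {R : realType} {d : Order.disp_t} {L : finTBLatticeType d}.
Context (sm : semimodular L).
Implicit Types (a b p q x y z u v w : L) (s t : L -> R).

(* [s] and [t] are the coordinates of a C1-diagram in the directions (1, 1)
   and (-1, 1); [s x = s y] says that an edge has direction (-1, 1). *)
Definition C1_coordinates a b s t : Prop :=
  [/\ forall x y, covers x y -> s x <= s y /\ t x <= t y,
      forall x y, covers x y -> (x `&` a = y `&` a \/ x `&` b = y `&` b)%O ->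
        s x = s y \/ t x = t y,
      forall x y, s x = s y -> t x = t y -> x = y
    & forall x y z, covers x y -> covers x z -> y != z ->
        (s x = s y -> s x = s z -> False) /\ (t x = t y -> t x = t z -> False)].

Lemma C1_coordinatesC a b s t : C1_coordinates a b s t -> C1_coordinates b a t s.
Proof.
case=> mono normal inj fork; split=> [x y /mono[]|x y /normal H [] e|x y h1 h2|x y z h1 h2 h3].
- by [].
- by apply/or_comm/H; right.
- by apply/or_comm/H; left.
- exact: inj.
- by have [] := fork x y z h1 h2 h3.
Qed.

Lemma C1_coordinates_swap a b s t : C1_coordinates a b s t -> C1_coordinates b a s t.
Proof.
case=> mono normal inj fork; split=> // x y /normal H [] e.
  by apply: H; right.
by apply: H; left.
Qed.

(** The edge is drawn as with [a] for left corner and [b] for right one: a move along [a] alone goes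
    up-left, a move along [b] alone up-right. *)
Definition oriented a b s t x y : Prop :=
  ((x `&` b = y `&` b)%O -> s x = s y) /\ ((x `&` a = y `&` a)%O -> t x = t y).

(** Each coordinate of [x] is the smaller of those of [y] and [z], and incomparability makes the two
    minima come from different elements. *)
Lemma two_covers_meet a b x y z : grid_pair a b ->
  covers x y -> covers x z -> y != z ->
  (x `&` b = y `&` b /\ x `&` a = z `&` a)%O \/
  (x `&` a = y `&` a /\ x `&` b = z `&` b)%O.
Proof.
move=> gab cxy cxz nyz; have m := covers_meet cxy cxz nyz.
have mE c : (x `&` c = (y `&` c) `&` (z `&` c))%O.
  by rewrite -m meetACA meetxx.
have nle : ~~ (y <= z)%O by apply: contraNN nyz => /(covers_incomp cxy cxz)->.
have nge : ~~ (z <= y)%O by apply: contraNN nyz => /(covers_incomp cxz cxy)->.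
rewrite !(mE a) !(mE b).
have [ya|za] := orP (grid_total_l gab y z); have [yb|zb] := orP (grid_total_r gab y z).
- by rewrite (le_grid gab y z) ya yb in nle.
- by right; rewrite (meet_l ya) (meet_r zb).
- by left; rewrite (meet_r za) (meet_l yb).
- by rewrite (le_grid gab z y) za zb in nge.
Qed.

(** The two covers keep different coordinates, so both edges are normal, and normal edges from one
    element have different directions. *)
Lemma oriented_other_cover a b s t x y z : grid_pair a b -> C1_coordinates a b s t ->
  covers x y -> covers x z -> oriented a b s t x y -> oriented a b s t x z.
Proof.
move=> gab [mono normal inj fork] cxy cxz oxy.
have [<-//|nyz] := eqVneq y z; case: oxy => sxy txy.
have [fs ft] := fork x y z cxy cxz nyz.
have nxz : x <> z by move=> e; move: (covers_lt cxz); rewrite e ltxx.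
have [[yb za]|[ya zb]] := two_covers_meet gab cxy cxz nyz; split=> e.
- by case: nxz; apply: (grid_inj gab).
- by have [/(fs (sxy yb))|] := normal x z cxz (or_introl za).
- by have [|/(ft (txy ya))] := normal x z cxz (or_intror zb).
- by case: nxz; apply: (grid_inj gab).
Qed.

(** If the upper edge had the direction of the lower edge under it, then [s] would be constant from
    [x] to [w], hence from [x] to [z]. As [t] already agrees at [x] and [z], these would be
    equal. *)
Lemma oriented_cell a b s t x y z w : grid_pair a b -> C1_coordinates a b s t ->
  covers x y -> covers x z -> y != z -> covers y w -> covers z w ->
  oriented a b s t x y -> oriented a b s t x z -> oriented a b s t y w.
Proof.
have half a' b' s' t' : grid_pair a' b' -> C1_coordinates a' b' s' t' ->
    covers x y -> covers x z -> y != z -> covers y w -> covers z w ->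
    oriented a' b' s' t' x y -> oriented a' b' s' t' x z ->
    (x `&` b' = y `&` b')%O -> (x `&` a' = z `&` a')%O -> oriented a' b' s' t' y w.
  move=> gab [mono normal inj fork] cxy cxz nyz cyw czw [sxy _] [_ txz] yb za.
  have nxz : x <> z by move=> e; move: (covers_lt cxz); rewrite e ltxx.
  split=> e.
    case: nxz; apply: (grid_inj gab) => //; apply/le_anti.
    by rewrite (leI2 (covers_le cxz)) //= yb e (leI2 (covers_le czw)).
  have [sw|//] := normal y w cyw (or_introl e).
  case: nxz; apply: inj; last exact: txz.
  apply/le_anti; have [-> _] := mono x z cxz; rewrite sxy // sw.
  by have [-> _] := mono z w czw.
move=> gab C1 cxy cxz nyz cyw czw oxy oxz.
have [[yb za]|[ya zb]] := two_covers_meet gab cxy cxz nyz; first exact: half.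
apply/and_comm; apply: half zb => //; first exact: grid_pairC.
- exact: C1_coordinatesC.
- exact/and_comm.
- exact/and_comm.
Qed.

(** Choose a corner [c] incomparable to [x], a lower cover [z] of [x] above their meet, and join to
    [z] an element covering that meet below [c]. *)
Lemma lower_cover_fork a b x : grid_pair a b -> (a `&` b = \bot)%O ->
  (a `|` b = \top)%O -> a != \bot%O -> b != \bot%O -> x != \bot%O -> x != \top%O ->
  exists z w, [/\ covers z x, covers z w & w != x].
Proof.
move=> gab mab jab a0 b0 x0 xt.
have half c : (x `&` c < x)%O -> (x `&` c < c)%O ->
    exists z w, [/\ covers z x, covers z w & w != x].
  move=> ltx ltc; have [z czx lez] := ex_lower_cover ltx.
  have [v cv lev] := ex_upper_cover ltc.
  have nvx : ~~ (v <= x)%O.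
    apply/negP => vx; move: (covers_lt cv).
    by rewrite lt_leAnge lexI vx lev andbF.
  exists z, (v `|` z)%O; split=> //.
    apply: (semimodular_cover_join sm cv lez).
    by apply: contraNN nvx => /le_trans; apply; apply: covers_le.
  by apply: contraNneq nvx => <-; apply: leUl.
have [xa|nxa] := boolP (x <= a)%O.
  have xb : (x `&` b = \bot)%O by apply/eqP; rewrite -lex0 -mab leI2.
  by apply: (half b); rewrite xb lt0x.
have [xb|nxb] := boolP (x <= b)%O.
  have xa : (x `&` a = \bot)%O by apply/eqP; rewrite -lex0 -mab meetC leI2.
  by apply: (half a); rewrite xa lt0x.
have [ax|nax] := boolP (a <= x)%O; last first.
  by apply: (half a); rewrite lt_neqAle ?leIl ?leIr andbT ?eq_meetl ?eq_meetr.
apply: (half b); rewrite lt_neqAle ?leIl ?leIr andbT ?eq_meetl ?eq_meetr //.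
by apply: contraNN xt => bx; rewrite -le1x -jab leUx ax.
Qed.

(** Induction upwards: the fork below [x] spans a covering square, which transports the orientation
    from the edges at [z] to one upper edge of [x], and from there to all its upper edges. *)
Lemma orientation_propagates a b s t : grid_pair a b -> (a `&` b = \bot)%O ->
  (a `|` b = \top)%O -> a != \bot%O -> b != \bot%O -> C1_coordinates a b s t ->
  (forall y, covers \bot%O y -> oriented a b s t \bot%O y) ->
  forall x y, covers x y -> oriented a b s t x y.
Proof.
move=> gab mab jab a0 b0 C1 base; elim/(@lt_wf_ind _ L) => x IH y cxy.
have [x0|x0] := eqVneq x \bot%O; first by rewrite x0 in cxy *; apply: base.
have xt : x != \top%O.
  by apply: contraTneq (covers_lt cxy) => ->; rewrite lt1x.
have [z [w [czx czw nwx]]] := lower_cover_fork gab mab jab a0 b0 x0 xt.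
have ltzx := covers_lt czx.
have cover_join u v : covers z u -> covers z v -> u != v -> covers u (v `|` u)%O.
  move=> cu cv nuv; apply: (semimodular_cover_join sm cv); first exact: covers_le.
  by apply: contraNN nuv => /(covers_incomp cv cu)->.
have cxj : covers x (w `|` x)%O by apply: cover_join; rewrite // eq_sym.
have cwj : covers w (w `|` x)%O by rewrite joinC; apply: cover_join.
apply: (oriented_other_cover gab C1 cxj cxy).
apply: (oriented_cell gab C1 czx czw _ cxj cwj (IH z ltzx x czx) (IH z ltzx w czw)).
by rewrite eq_sym.
Qed.

(** The edge from the bottom to an atom below [a] is normal, and its direction decides between the
    two orientations. *)
Lemma orientation_exists a b s t : grid_pair a b -> (a `&` b = \bot)%O ->
  (a `|` b = \top)%O -> a != \bot%O -> b != \bot%O -> C1_coordinates a b s t ->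
  (forall x y, covers x y -> oriented a b s t x y) \/
  (forall x y, covers x y -> oriented b a s t x y).
Proof.
move=> gab mab jab a0 b0 C1; have gba := grid_pairC gab.
have [p cp lepa] : exists2 p, covers \bot%O p & (p <= a)%O.
  by apply: ex_upper_cover; rewrite lt0x.
have pb : (p `&` b = \bot)%O by apply/eqP; rewrite -lex0 -mab leI2.
have npa : (\bot `&` a)%O <> (p `&` a)%O.
  by rewrite meet0x (meet_l lepa) => e; move: (covers_lt cp); rewrite -e ltxx.
have C1' := C1_coordinates_swap C1.
have [_ normal _ _] := C1.
have [e|e] : s \bot%O = s p \/ t \bot%O = t p.
  by apply: (normal _ _ cp); right; rewrite meet0x pb.
- left; apply: orientation_propagates => // y cy.
  by apply: (oriented_other_cover gab C1 cp cy); split.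
- right; apply: orientation_propagates => //; rewrite 1?meetC 1?joinC // => y cy.
  by apply: (oriented_other_cover gba C1' cp cy); split.
Qed.

Lemma coordinate_const a b s t x y : grid_pair a b ->
  (forall x y, covers x y -> oriented a b s t x y) ->
  (x <= y)%O -> (x `&` b = y `&` b)%O -> s x = s y.
Proof.
move=> gab or lexy; have [c pc lastc] := covers_path lexy.
elim: c x pc lastc {lexy} => [|z c IH] x /=; first by move=> _ ->.
move=> /andP[cxz pc] lastc e.
have lezy : (z <= y)%O by rewrite -lastc path_covers_le_last ?mem_head.
have ez : (x `&` b = z `&` b)%O.
  apply/le_anti; rewrite (leI2 (covers_le cxz)) //= e leI2 //.
have [sxz _] := or x z cxz; rewrite sxz //.
by apply: (IH z pc lastc); rewrite -ez.
Qed.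

Lemma coordinates_mono s : (forall x y, covers x y -> s x <= s y) ->
  forall x y, (x <= y)%O -> s x <= s y.
Proof.
move=> mono x y /covers_path[c pc lastc].
elim: c x pc lastc => [|z c IH] x /=; first by move=> _ ->.
move=> /andP[cxz pc] lastc; exact: le_trans (mono _ _ cxz) (IH z pc lastc).
Qed.

(** Below [b] all meets with [a] are the bottom, so [t] is constant there and [s] must separate
    elements. *)
Lemma oriented_increasing a b s t : grid_pair a b -> (a `&` b = \bot)%O ->
  C1_coordinates a b s t -> (forall x y, covers x y -> oriented a b s t x y) ->
  strictly_increasing_below b s.
Proof.
move=> gab mab [mono _ inj _] or x y ltxy leyb.
rewrite lt_neqAle (coordinates_mono (fun u v c => proj1 (mono u v c)) (ltW ltxy)).
rewrite andbT; apply: contraTneq (ltxy) => e.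
have a0 z : (z <= b)%O -> (z `&` a = \bot)%O.
  by move=> zb; apply/eqP; rewrite -lex0 -mab meetC leI2.
rewrite (inj x y e) ?ltxx //.
apply: (@coordinate_const b a t s) => [|u v /or/and_comm//||].
- exact: grid_pairC.
- exact: ltW.
- by rewrite !a0 // (le_trans (ltW ltxy)).
Qed.

End Orientation.

(** * C1-diagrams are natural *)

Section C1Diagrams.
Local Open Scope ring_scope.
Context {R : realType} {d : Order.disp_t} {L : finTBLatticeType d}.

(** An edge keeping a coordinate is no middle edge of a peak, hence normal; the fork condition is
    planarity in the form of [cross_covers_neq0]. *)
Lemma C1_diagram_coordinates (a b : L) (D : L -> R * R) : grid_pair a b ->
  (a `&` b = \bot)%O -> C1_diagram D ->
  C1_coordinates a b (fun x => ((D x).1 + (D x).2) / 2)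
    (fun x => ((D x).2 - (D x).1) / 2).
Proof.
move=> gab mab [hD edge].
have normal x y : covers x y -> (x `&` a = y `&` a \/ x `&` b = y `&` b)%O ->
    normal_edge (D x) (D y).
  move=> cxy e; apply: (proj2 (edge x y cxy)) => pk.
  have := peak_middle_edge_neq gab pk.
  have := peak_middle_edge_neq (grid_pairC gab) pk.
  by case: e => ->; rewrite eqxx.
have [inj up _] := hD; split.
- move=> x y cxy.
  have : `|(D y).1 - (D x).1| <= (D y).2 - (D x).2.
    have [ea|na] := eqVneq (x `&` a)%O (y `&` a)%O.
      by rewrite (eqP (normal _ _ cxy _)) //; left.
    have [eb|nb] := eqVneq (x `&` b)%O (y `&` b)%O.
      by rewrite (eqP (normal _ _ cxy _)) //; right.
    by apply/ltW/(proj1 (edge x y cxy)); apply: neq_peak_middle_edge gab mab cxy na nb.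
  by rewrite ler_norml => /andP[h1 h2]; split; lra.
- move=> x y cxy /(normal x y cxy)/eqP.
  have := up x y cxy.
  by case: (ger0P ((D y).1 - (D x).1)) => _ h e; [right|left]; lra.
- move=> x y e1 e2; apply: inj; rewrite [LHS]surjective_pairing [RHS]surjective_pairing.
  by congr (_, _); lra.
- move=> x y z cxy cxz nyz.
  have c0 : cross (D x) (D z) (D y) != 0 by apply: (cross_covers_neq0 hD).
  split=> e1 e2; case/eqP: c0; rewrite /cross.
    have -> : (D y).1 = (D x).1 + (D x).2 - (D y).2 by lra.
    have -> : (D z).1 = (D x).1 + (D x).2 - (D z).2 by lra.
    by ring.
  have -> : (D y).1 = (D x).1 - (D x).2 + (D y).2 by lra.
  have -> : (D z).1 = (D x).1 - (D x).2 + (D z).2 by lra.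
  by ring.
Qed.

(** By orientation, [s] depends only on the meet with [b] and [t] only on the meet with [a], so they
    serve as [rho] and [lam]. *)
Lemma oriented_natural (a b : L) (D : L -> R * R) : corner_pair a b ->
  grid_pair a b -> C1_diagram D ->
  (forall x y, covers x y -> oriented a b (fun x => ((D x).1 + (D x).2) / 2)
    (fun x => ((D x).2 - (D x).1) / 2) x y) ->
  natural_diagram D D.
Proof.
move=> cab gab C1 or; have [[mab jab] _ _ _] := cab.
have cc := C1_diagram_coordinates gab mab C1.
set s := (fun x => ((D x).1 + (D x).2) / 2) in or cc.
set t := (fun x => ((D x).2 - (D x).1) / 2) in or cc.
have or' x y : covers x y -> oriented b a t s x y by move/or/and_comm.
have gba := grid_pairC gab.
have incs : strictly_increasing_below b s by apply: oriented_increasing cc or.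
have inct : strictly_increasing_below a t.
  by apply: oriented_increasing (C1_coordinatesC cc) or'; rewrite // meetC.
have DE x : D x = grid_point t s (psi a b x).
  have sE : s (x `&` b)%O = s x.
    by apply: (coordinate_const gab or); rewrite ?leIl // -meetA meetxx.
  have tE : t (x `&` a)%O = t x.
    by apply: (coordinate_const gba or'); rewrite ?leIl // -meetA meetxx.
  rewrite /grid_point /psi /= sE tE /s /t [LHS]surjective_pairing.
  by congr (_, _); field.
exists a, b; split; last by exists t, s; split.
exact: natural_rectangular_corners DE cab.
Qed.

End C1Diagrams.

Theorem theorem14 (R : realType) (d : Order.disp_t) (L : finTBLatticeType d)
    (hL : slim_rectangular R L) :
  (forall D0 D : L -> R * R,
     is_diagram D0 -> natural_diagram D0 D -> C1_diagram D) /\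
  (forall D : L -> R * R, C1_diagram D -> natural_diagram D D).
Proof.
case: hL => [[sm [D1 hD1 [lc [rc hc]]]] sl]; split.
  move=> D0 D hD0 [a [b [hab [lam [rho [hlam hrho DE]]]]]].
  have cab := rectangular_corner_pair hD0 sm sl hab.
  have gab := corner_pair_grid sm (no_three_covers hD0 sm sl) cab.
  by case: (cab) => [[mab _] _ _ _]; apply: natural_diagram_C1 DE.
(* The corners come from the diagram [D1] given by rectangularity; which of them is on the left in
   [D] is decided by the orientation. *)
move=> D C1; have cab := rectangular_corner_pair hD1 sm sl hc.
have gab := corner_pair_grid sm (no_three_covers hD1 sm sl) cab.
have [[mab jab] [a0 _ _] [b0 _ _] _] := cab.
have cc := C1_diagram_coordinates gab mab C1.
have [or|or] := orientation_exists sm gab mab jab a0 b0 cc.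
  exact: oriented_natural cab gab C1 or.
apply: oriented_natural C1 or; first exact: corner_pairC.
exact: grid_pairC.
Qed.
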